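(* (ZF) Let $U$ be a $\sigma$-complete ultrafilter on a set $X$. A sequence $\vec x=\langle x_i: i<\omega\rangle\in X^\omega$ (possibly lying in an outer model of $V$) generates a generic filter for the tree Prikry forcing $\mathbb{P}(U)$, i.e. the filter $G(\vec x)$ is $V$-generic for $\mathbb{P}(U)$, if and only if for every Global Predicate System $\Phi$ for $U$ (in $V$) there is some $m<\omega$ such that $\vec x\setminus m$ fits the $U$-Subtree-Predicate-System $\Phi(\vec x\restriction m)$.
   Context: The base theory is ZF (no choice). $\sigma$-complete means closed under countable intersections. For $\vec x\in X^\omega$ and $k<\omega$, $\vec x\restriction k=\langle x_i:i<k\rangle$ and $\vec x\setminus k$ is the tail $\langle x_i: k\le i<\omega\rangle$, re-indexed as an $\omega$-sequence; $[T]$ is the set of infinite branches of a tree $T$. Tree Prikry forcing $\mathbb{P}(U)$: conditions are pairs $p=(s,T)$ where $s\in X^{<\omega}$ and $T\subseteq X^{<\omega}$ is a $U$-large tree, i.e. a tree with $\langle\rangle\in T$ and $\mathrm{succ}_T(t)=\{x: t^\frown\langle x\rangle\in T\}\in U$ for every $t\in T$. For $r\in T$ let $T_r=\{t: r^\frown t\in T\}$. A direct extension of $(s,T)$ is $(s,T')$ with $T'\subseteq T$; a one-point extension of $(s,T)$ is $(s^\frown\langle x\rangle,T_{\langle x\rangle})$ with $x\in\mathrm{succ}_T(\langle\rangle)$. A condition $q$ extends $p$ if it is obtained from $p$ by finitely many one-point extensions and direct extensions. A $U$-Subtree-Predicate-System ($U$-SPS) is a triple $(T,n,P)$ such that: $T$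 is a $U$-large tree; $n<\omega$; $P$ is a predicate on pairs $(t,S)$ where $t$ is a finite sequence of length at least $n$ and $S$ is a $U$-large sub-tree of $T_t$; and for every $t\in T$ of length $|t|\ge n$ the set $\{S: P(t,S)\}$ is nonempty and downwards closed. A sequence $\vec x=\langle x_i: i<\omega\rangle$ fits $(T,n,P)$ if $\vec x$ is a branch through $T$ and there are $k\ge n$ and a $U$-large sub-tree $S$ of $T_{\vec x\restriction k}$ such that $P(\vec x\restriction k,S)$ holds and $\vec x\setminus k$ is a branch through $S$. A Global Predicate System (GPS) for $U$ is an assignment $\Phi$ with domain $X^{<\omega}$ such that for every $r\in X^{<\omega}$, $\Phi(r)=(T^r,n^r,P^r)$ is a $U$-SPS. The filter generated by $\vec x\in X^\omega$ is $G(\vec x)=\{(\vec x\restriction k,T): k<\omega,\ T\text{ is }U\text{-large, and }\vec x\setminus k\in[T]\}$. *)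

(* Defs.v *)
(* Plain Rocq, no library beyond the prelude.

   The theorem is a ZF theorem about a ground model V and an outer model W.
   Both are arbitrary (possibly ill-founded) first-order structures satisfying
   ZF, and every set-theoretic notion is a formula about such a structure: all
   sequences, trees, predicates and natural numbers are elements of it. *)

Set Implicit Arguments.
Unset Strict Implicit.
Unset Printing Implicit Defensive.

Class SetStr (M : Type) := mem : M -> M -> Prop.
Notation "a ∈ b" := (mem a b) (at level 70, no associativity).

(* De Bruijn indices: [FAll] binds the variable 0. *)
Inductive fml : Type :=
| FMem (i j : nat)
| FEq (i j : nat)
| FFalse
| FImp (f g : fml)
| FAll (f : fml).

Definition scons {M : Type} (a : M) (e : nat -> M) : nat -> M :=
  fun i => match i with O => a | S i => e i end.

Fixpoint sat {M : Type} {E : SetStr M} (f : fml) (e : nat -> M) : Prop :=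
  match f with
  | FMem i j => e i ∈ e j
  | FEq i j => e i = e j
  | FFalse => False
  | FImp f g => sat f e -> sat g e
  | FAll f => forall a, sat f (scons a e)
  end.

Section SetTheory.
Context {M : Type} {E : SetStr M}.

Definition subset (a b : M) : Prop := forall z, z ∈ a -> z ∈ b.
Definition is_empty (a : M) : Prop := forall z, ~ z ∈ a.
Definition is_upair (a b c : M) : Prop := forall z, z ∈ c <-> z = a \/ z = b.
(* s = n ∪ {n} *)
Definition is_succ (n s : M) : Prop := forall z, z ∈ s <-> z ∈ n \/ z = n.
Definition inductive_set (w : M) : Prop :=
  (exists e, is_empty e /\ e ∈ w) /\
  (forall n, n ∈ w -> exists s, is_succ n s /\ s ∈ w).

(* Separation and replacement are schemes over first-order formulas with
   parameters (given by the environment [e]). *)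
Record ZF : Prop := {
  ZF_extensionality : forall a b, (forall z, z ∈ a <-> z ∈ b) -> a = b;
  ZF_foundation : forall a, (exists z, z ∈ a) ->
    exists z, z ∈ a /\ ~ exists y, y ∈ z /\ y ∈ a;
  ZF_pairing : forall a b, exists c, is_upair a b c;
  ZF_union : forall a, exists u, forall z, z ∈ u <-> exists y, y ∈ a /\ z ∈ y;
  ZF_powerset : forall a, exists p, forall z, z ∈ p <-> subset z a;
  ZF_infinity : exists w, inductive_set w;
  ZF_separation : forall (f : fml) (e : nat -> M) a,
    exists b, forall z, z ∈ b <-> z ∈ a /\ sat f (scons z e);
  ZF_replacement : forall (f : fml) (e : nat -> M) a,
    (forall y, y ∈ a -> exists! z, sat f (scons z (scons y e))) ->
    exists b, forall z,
      z ∈ b <-> exists y, y ∈ a /\ sat f (scons z (scons y e))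
}.

Definition transitive_set (a : M) : Prop := forall z, z ∈ a -> subset z a.
Definition ordinal (a : M) : Prop :=
  transitive_set a /\ forall z, z ∈ a -> transitive_set z.

(* n ∈ ω *)
Definition is_nat (n : M) : Prop := forall w, inductive_set w -> n ∈ w.
Definition is_omega (w : M) : Prop := forall n, n ∈ w <-> is_nat n.
Definition leq (m n : M) : Prop := m ∈ n \/ m = n.

(* Kuratowski pairs *)
Definition is_pair (a b p : M) : Prop :=
  exists u v, is_upair a a u /\ is_upair a b v /\ is_upair u v p.
Definition is_triple (a b c p : M) : Prop :=
  exists q, is_pair a b q /\ is_pair q c p.

(* The pair (a,b) belongs to f; for a function f this says f(a) = b. *)
Definition rel (f a b : M) : Prop := exists p, is_pair a b p /\ p ∈ f.

Definition is_fun (f D : M) : Prop :=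
  (forall p, p ∈ f -> exists a b, is_pair a b p /\ a ∈ D) /\
  (forall a, a ∈ D -> exists! b, rel f a b).
Definition is_fun_to (f D Y : M) : Prop :=
  is_fun f D /\ forall a b, rel f a b -> b ∈ Y.

(* A chain a = f(0) R f(1) R ... R f(n) = b, where n and f are in the
   structure. *)
Definition chain (R : M -> M -> Prop) (a n b : M) : Prop :=
  exists f N, is_succ n N /\ is_fun f N /\
    (exists e, is_empty e /\ rel f e a) /\ rel f n b /\
    forall i i' u v, i ∈ n -> is_succ i i' -> rel f i u -> rel f i' v -> R u v.

(* k = m + n *)
Definition is_add (m n k : M) : Prop := chain is_succ m n k.

(* s ∈ X^n, s ∈ X^{<ω} and x ∈ X^ω *)
Definition seq_of_len (X n s : M) : Prop := is_nat n /\ is_fun_to s n X.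
Definition finseq (X s : M) : Prop := exists n, seq_of_len X n s.
Definition omega_seq (X x : M) : Prop :=
  exists w, is_omega w /\ is_fun_to x w X.

Definition is_dom (s n : M) : Prop := forall i, i ∈ n <-> exists b, rel s i b.

(* s = x↾k *)
Definition is_restr (x k s : M) : Prop :=
  forall p, p ∈ s <-> p ∈ x /\ exists i b, i ∈ k /\ is_pair i b p.

(* y = x∖k, re-indexed: y(i) = x(k+i) *)
Definition is_tail (x k y : M) : Prop :=
  forall p, p ∈ y <->
    exists i l b, is_nat i /\ is_add k i l /\ rel x l b /\ is_pair i b p.

(* u = s⌢t, for finite sequences s and t *)
Definition is_concat (s t u : M) : Prop :=
  exists n, is_dom s n /\
    forall p, p ∈ u <->
      p ∈ s \/ exists i l b, rel t i b /\ is_add n i l /\ is_pair l b p.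

(* t = ⟨a⟩ *)
Definition is_single (a t : M) : Prop :=
  exists e p, is_empty e /\ is_pair e a p /\ is_upair p p t.

(* u = s⌢⟨a⟩ *)
Definition is_snoc (s a u : M) : Prop :=
  exists t, is_single a t /\ is_concat s t u.

Definition sigma_complete_ultrafilter (X U : M) : Prop :=
  (forall A, A ∈ U -> subset A X) /\
  X ∈ U /\
  (forall e, is_empty e -> ~ e ∈ U) /\
  (forall A B, A ∈ U -> subset A B -> subset B X -> B ∈ U) /\
  (forall A B C, A ∈ U -> B ∈ U ->
    (forall z, z ∈ C <-> z ∈ A /\ z ∈ B) -> C ∈ U) /\
  (forall A B, subset A X -> (forall z, z ∈ B <-> z ∈ X /\ ~ z ∈ A) ->
    A ∈ U \/ B ∈ U) /\
  (forall w f B, is_omega w -> is_fun_to f w U ->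
    (forall z, z ∈ B <-> z ∈ X /\ forall i A, rel f i A -> z ∈ A) -> B ∈ U).

Definition is_tree (X T : M) : Prop :=
  (forall t, t ∈ T -> finseq X t) /\
  (forall t k s, t ∈ T -> is_nat k -> is_restr t k s -> s ∈ T).

(* A = succ_T(t) *)
Definition is_succ_set (T t A : M) : Prop :=
  forall a, a ∈ A <-> exists u, is_snoc t a u /\ u ∈ T.

Definition large_tree (X U T : M) : Prop :=
  is_tree X T /\
  (exists e, is_empty e /\ e ∈ T) /\
  (forall t, t ∈ T -> exists A, is_succ_set T t A /\ A ∈ U).

(* T' = T_r *)
Definition is_tree_at (X T r T' : M) : Prop :=
  forall t, t ∈ T' <-> finseq X t /\ exists u, is_concat r t u /\ u ∈ T.

(* S is a U-large sub-tree of T_t *)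
Definition large_subtree_at (X U T t S : M) : Prop :=
  large_tree X U S /\ exists R, is_tree_at X T t R /\ subset S R.

(* x ∈ [T], for an ω-sequence x *)
Definition branch (x T : M) : Prop :=
  forall k, is_nat k -> exists s, is_restr x k s /\ s ∈ T.

(* p = (s,T) is a condition of the tree Prikry forcing P(U) *)
Definition condition_pair (X U s T p : M) : Prop :=
  is_pair s T p /\ finseq X s /\ large_tree X U T.
Definition condition (X U p : M) : Prop :=
  exists s T, condition_pair X U s T p.

(* In the next three definitions q is the stronger condition. *)
Definition direct_extension (X U p q : M) : Prop :=
  exists s T T', condition_pair X U s T p /\ condition_pair X U s T' q /\
    subset T' T.

Definition one_point_extension (X U p q : M) : Prop :=
  exists s T a e A l s' T',
    condition_pair X U s T p /\
    is_empty e /\ is_succ_set T e A /\ a ∈ A /\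
    is_snoc s a s' /\ is_single a l /\ is_tree_at X T l T' /\
    is_pair s' T' q.

Definition extends (X U p q : M) : Prop :=
  condition X U p /\
  exists n, is_nat n /\
    chain (fun u v => direct_extension X U u v \/ one_point_extension X U u v)
      p n q.

Definition dense (X U D : M) : Prop :=
  (forall p, p ∈ D -> condition X U p) /\
  (forall p, condition X U p -> exists q, q ∈ D /\ extends X U p q).

(* Filters are predicates, since those of interest are not in the ground
   model. *)
Definition is_filter (X U : M) (G : M -> Prop) : Prop :=
  (forall p, G p -> condition X U p) /\
  (exists p, G p) /\
  (forall p q, G q -> extends X U p q -> G p) /\
  (forall p q, G p -> G q -> exists r, G r /\ extends X U p r /\ extends X U q r).

Definition generic (X U : M) (G : M -> Prop) : Prop :=
  is_filter X U G /\
  forall D, dense X U D -> exists p, p ∈ D /\ G p.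

(* The predicate P is a set of pairs (t,S), and P(t,S) is [rel P t S]. *)
Definition SPS (X U T n P : M) : Prop :=
  large_tree X U T /\
  is_nat n /\
  (forall p, p ∈ P -> exists t S l, is_pair t S p /\
    seq_of_len X l t /\ leq n l /\ large_subtree_at X U T t S) /\
  (forall t l, t ∈ T -> seq_of_len X l t -> leq n l ->
    (exists S, rel P t S) /\
    (forall S S', rel P t S -> large_tree X U S' -> subset S' S -> rel P t S')).

Definition GPS (X U Phi : M) : Prop :=
  (exists D, (forall r, r ∈ D <-> finseq X r) /\ is_fun Phi D) /\
  (forall r v, rel Phi r v ->
    exists T n P, is_triple T n P v /\ SPS X U T n P).

End SetTheory.

Arguments ZF M {E}.

(* W is an outer model of V (via j): up to the embedding j, V is a transitive
   class of W containing all ordinals of W. *)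
Record outer_model (V W : Type) {EV : SetStr V} {EW : SetStr W}
    (j : V -> W) : Prop := {
  outer_inj : forall a b, j a = j b -> a = b;
  outer_mem : forall a b, j a ∈ j b <-> a ∈ b;
  outer_transitive : forall a w, w ∈ j a -> exists b, w = j b;
  outer_ordinals : forall w, ordinal w -> exists a, w = j a
}.
Arguments outer_model V W {EV EW} j.

Section Outer.
Context {V W : Type} {EV : SetStr V} {EW : SetStr W}.
Variable j : V -> W.

(* The filter G(x): its members are conditions of V, but x, its restrictions
   and its tails are computed in W. *)
Definition generated_filter (X U : V) (x : W) (p : V) : Prop :=
  exists (s T : V) (k y : W),
    condition_pair X U s T p /\ is_nat k /\ is_restr x k (j s) /\
    is_tail x k y /\ branch y (j T).

Definition fits (X U T n P : V) (x : W) : Prop :=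
  branch x (j T) /\
  exists (k y : W) (t S : V),
    is_nat k /\ leq (j n) k /\ is_restr x k (j t) /\
    large_subtree_at X U T t S /\ rel P t S /\
    is_tail x k y /\ branch y (j S).

(* x∖m fits the system Phi(x↾m) *)
Definition tail_fits (X U Phi : V) (x m : W) : Prop :=
  exists (r v T n P : V) (y : W),
    is_restr x m (j r) /\ rel Phi r v /\ is_triple T n P v /\
    is_tail x m y /\ fits X U T n P y.

End Outer.

(* Main.v *)
Require Import Defs.
From Stdlib Require Import Classical ClassicalEpsilon PeanoNat.

(** A condition that extends another one is said to be below it. The order has a
    closed form ([extendsE]): [(s, T)] is extended exactly by the [(s^t, S)] with
    [t] in [T] and [S] a large tree contained in [T_t].
    Consequently [G(x)] is a filter for every sequence [x] ([gen_filter]): two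
    of its members sit on stems [x|k] and [x|(k+l)], and the tree of the first,
    moved to the longer stem, can be intersected with the tree of the second.
    Only the dense sets are at stake.

    If [G(x)] is generic and [Phi] is a system, consider the conditions
    [(r^t, S)] with [P^r(t, S)]. They are dense: below [(s, T)] take [t] of
    length [n^s] in the intersection of [T] and [T^s], then [S] with [P^s(t, S)],
    and shrink [S]. A member of [G(x)] of this form says that the tail of [x]
    after [r] fits [Phi(r)] ([generic_fits]).

    Conversely let [D] be dense. Call a stem decided when some condition on it
    lies below an element of [D], and say that [s] is good of rank [n] when some
    large tree [T] has [s^u] decided for all [u] in [T] of length at least [n].
    Every stem is good of some rank ([all_good]). Otherwise take a stem [s] that
    is not: if almost all one-point extensions of a stem were good, countable
    completeness would give them a common rank, and their trees could be grafted
    into a witness for the stem itself; hence a stem that is not good stays so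
    after almost every further point, and the stems that are not good form a
    large tree on top of [s]. An element of [D] below the resulting condition
    makes one of them decided, hence good, a contradiction. Now let [Phi(s)]
    consist of the least rank [n] of [s], a witness [T], and the predicate
    saying that [(s^t, S)] is below an element of [D]. If a tail of [x] fits
    this system, then [G(x)] meets [D] ([fits_meets]).

    No choice is available, neither for grafting nor for defining [Phi]. It is
    avoided because witnesses of rank [n] are closed under unions, so the union
    of all of them ([hull]) is a canonical one.

    The ground model enters through first-order separation and replacement only,
    which is why definability of every predicate in use has to be tracked; and
    the outer model enters through the finite pieces of [x] only, all of which
    belong to the ground model ([fin_j_inv]). The combinatorial part can
    therefore be carried out inside the ground model, for an external function
    giving these pieces ([gen_generic]). *)

Set Implicit Arguments.
Unset Strict Implicit.
Unset Printing Implicit Defensive.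

Existing Class ZF.

(** * Definable predicates and terms *)

Fixpoint ren (r : nat -> nat) (f : fml) : fml :=
  match f with
  | FMem i j => FMem (r i) (r j)
  | FEq i j => FEq (r i) (r j)
  | FFalse => FFalse
  | FImp f g => FImp (ren r f) (ren r g)
  | FAll f => FAll (ren (fun i => match i with O => O | S i => S (r i) end) f)
  end.

Section Definability.
Context {M : Type} {E : SetStr M}.

Lemma sat_ext (f : fml) : forall e e' : nat -> M,
  (forall i, e i = e' i) -> (sat f e <-> sat f e').
Proof.
  induction f as [i j|i j| |f IHf g IHg|f IHf]; simpl; intros e e' H.
  - rewrite !H; tauto.
  - rewrite !H; tauto.
  - tauto.
  - rewrite (IHf _ _ H), (IHg _ _ H); tauto.
  - split; intros K a;
      [apply (IHf (scons a e) (scons a e')) | apply (IHf (scons a e) (scons a e'))];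
      auto; intros [|i]; simpl; auto.
Qed.

Lemma sat_ren (f : fml) : forall (r : nat -> nat) (e : nat -> M),
  sat (ren r f) e <-> sat f (fun i => e (r i)).
Proof.
  induction f as [i j|i j| |f IHf g IHg|f IHf]; simpl; intros r e; try tauto.
  - rewrite IHf, IHg; tauto.
  - split; intros K a; specialize (K a); rewrite IHf in *;
      refine (proj1 (sat_ext _ _) K); intros [|i]; reflexivity.
Qed.

Definition look (e : nat -> M) (v : nat + M) : M :=
  match v with inl i => e i | inr a => a end.

(** Parameters are built in: [r] sends each free variable of the formula either
    to a variable of the environment or to a fixed element of the structure. *)
Definition definable (P : (nat -> M) -> Prop) : Prop :=
  exists f (r : nat -> nat + M), forall e, sat f (fun i => look e (r i)) <-> P e.

(** A term is definable through its graph, the value being variable 0. *)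
Definition definable_term (u : (nat -> M) -> M) : Prop :=
  definable (fun e => e 0 = u (fun i => e (S i))).

Lemma definable_ext (P Q : (nat -> M) -> Prop) :
  (forall e, P e <-> Q e) -> definable P -> definable Q.
Proof.
  intros H (f & r & K); exists f, r; intro e; rewrite <- H; apply K.
Qed.

Lemma definable_mem_var i j : definable (fun e => e i ∈ e j).
Proof.
  exists (FMem 0 1), (fun k => match k with O => inl i | _ => inl j end).
  simpl; tauto.
Qed.

Lemma definable_eq_var i j : definable (fun e => e i = e j).
Proof.
  exists (FEq 0 1), (fun k => match k with O => inl i | _ => inl j end).
  simpl; tauto.
Qed.

Lemma definable_False : definable (fun _ => False).
Proof. exists FFalse, (fun k => inl k); simpl; tauto. Qed.

Lemma definable_imp (P Q : (nat -> M) -> Prop) :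
  definable P -> definable Q -> definable (fun e => P e -> Q e).
Proof.
  intros (f & r & Hf) (g & q & Hg).
  (* The free variables of the two formulas are kept apart by parity. *)
  exists (FImp (ren (fun i => 2 * i) f) (ren (fun i => S (2 * i)) g)).
  exists (fun k => if Nat.even k then r (Nat.div2 k) else q (Nat.div2 k)).
  intro e. rewrite <- Hf, <- Hg.
  cbn [sat].
  rewrite !sat_ren.
  rewrite (sat_ext f (e' := fun i => look e (r i))).
  - rewrite (sat_ext g (e' := fun i => look e (q i))); [tauto|].
    intro i. rewrite Nat.even_succ, Nat.odd_mul, Nat.div2_succ_double.
    reflexivity.
  - intro i. rewrite Nat.even_mul, Nat.div2_double. reflexivity.
Qed.

Lemma definable_all (P : (nat -> M) -> M -> Prop) :
  definable (fun e => P (fun i => e (S i)) (e 0)) ->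
  definable (fun e => forall a, P e a).
Proof.
  intros (f & r & Hf).
  exists (FAll (ren (fun i => match r i with inl O => O | _ => S i end) f)).
  exists (fun k => match r k with inl (S i) => inl i | v => v end).
  intro e; simpl sat.
  split; intros K a; specialize (K a).
  - apply (Hf (scons a e)). rewrite sat_ren in K.
    refine (proj1 (sat_ext _ _) K). intro i; cbv beta.
    destruct (r i) as [[|k]|b] eqn:Hr; simpl; rewrite ?Hr; reflexivity.
  - rewrite sat_ren. apply (Hf (scons a e)) in K.
    refine (proj1 (sat_ext _ _) K). intro i; cbv beta.
    destruct (r i) as [[|k]|b] eqn:Hr; simpl; rewrite ?Hr; reflexivity.
Qed.

Lemma definable_ren (g : nat -> nat) (P : (nat -> M) -> Prop) :
  definable P -> definable (fun e => P (fun i => e (g i))).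
Proof.
  intros (f & r & H).
  exists f, (fun i => match r i with inl k => inl (g k) | v => v end).
  intro e. rewrite <- (H (fun i => e (g i))).
  apply sat_ext; intro i; destruct (r i); reflexivity.
Qed.

Lemma definable_not (P : (nat -> M) -> Prop) :
  definable P -> definable (fun e => ~ P e).
Proof. intro H; exact (definable_imp H definable_False). Qed.

Lemma definable_and (P Q : (nat -> M) -> Prop) :
  definable P -> definable Q -> definable (fun e => P e /\ Q e).
Proof.
  intros HP HQ.
  refine (definable_ext _ (definable_not (definable_imp HP (definable_not HQ)))).
  intro e; tauto.
Qed.

Lemma definable_or (P Q : (nat -> M) -> Prop) :
  definable P -> definable Q -> definable (fun e => P e \/ Q e).
Proof.
  intros HP HQ.
  refine (definable_ext _ (definable_imp (definable_not HP) HQ)).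
  intro e; tauto.
Qed.

Lemma definable_iff (P Q : (nat -> M) -> Prop) :
  definable P -> definable Q -> definable (fun e => P e <-> Q e).
Proof.
  intros HP HQ.
  exact (definable_and (definable_imp HP HQ) (definable_imp HQ HP)).
Qed.

Lemma definable_ex (P : (nat -> M) -> M -> Prop) :
  definable (fun e => P (fun i => e (S i)) (e 0)) ->
  definable (fun e => exists a, P e a).
Proof.
  intro H.
  refine (definable_ext _ (definable_not
            (definable_all (P := fun e a => ~ P e a) (definable_not H)))).
  intro e; cbv beta; split.
  - intro K. apply NNPP. intro L. apply K. intros a Ha. apply L. exists a; exact Ha.
  - intros [a Ha] K. exact (K a Ha).
Qed.

(** A definable term is substituted by quantifying over its unique value, so no
    operation on formulas is needed. *)
Lemma definable_subst (P : (nat -> M) -> M -> Prop) (u : (nat -> M) -> M) :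
  definable_term u -> definable (fun e => P (fun i => e (S i)) (e 0)) ->
  definable (fun e => P e (u e)).
Proof.
  intros Hu HP.
  refine (definable_ext _ (definable_all (P := fun e a => a = u e -> P e a)
            (definable_imp Hu HP))).
  intro e; split; [auto | intros H a ->; exact H].
Qed.

Lemma definable_term_var i : definable_term (fun e => e i).
Proof. exact (definable_eq_var 0 (S i)). Qed.

Lemma definable_term_const a : definable_term (fun _ => a).
Proof.
  exists (FEq 0 1), (fun k => match k with O => inl 0 | _ => inr a end).
  simpl; tauto.
Qed.

Lemma definable_term_ren (g : nat -> nat) u :
  definable_term u -> definable_term (fun e => u (fun i => e (g i))).
Proof.
  intro H.
  exact (definable_ren (fun i => match i with O => O | S i => S (g i) end) H).
Qed.

(** Relations and operations are registered on variables; the composition lemmas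
    below extend them to arbitrary definable arguments. *)
Class Def1 (R : M -> Prop) : Prop := def1 : definable (fun e => R (e 0)).
Class Def2 (R : M -> M -> Prop) : Prop :=
  def2 : definable (fun e => R (e 0) (e 1)).
Class Def3 (R : M -> M -> M -> Prop) : Prop :=
  def3 : definable (fun e => R (e 0) (e 1) (e 2)).

Lemma definable_app1 (R : M -> Prop) (H : Def1 R) u :
  definable_term u -> definable (fun e => R (u e)).
Proof.
  intro Hu.
  exact (definable_subst (P := fun _ a => R a) Hu H).
Qed.

Lemma definable_app2 (R : M -> M -> Prop) (H : Def2 R) u v :
  definable_term u -> definable_term v -> definable (fun e => R (u e) (v e)).
Proof.
  intros Hu Hv.
  refine (definable_subst (P := fun e a => R a (v e)) Hu _).
  refine (definable_subst (P := fun e a => R (e 0) a) (definable_term_ren S Hv) _).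
  exact (definable_ren (fun i => match i with O => 1 | _ => 0 end) H).
Qed.

Lemma definable_app3 (R : M -> M -> M -> Prop) (H : Def3 R) u v w :
  definable_term u -> definable_term v -> definable_term w ->
  definable (fun e => R (u e) (v e) (w e)).
Proof.
  intros Hu Hv Hw.
  refine (definable_subst (P := fun e a => R a (v e) (w e)) Hu _).
  refine (definable_subst (P := fun e a => R (e 0) a (w (fun i => e (S i))))
            (definable_term_ren S Hv) _).
  refine (definable_subst (P := fun e a => R (e 1) (e 0) a)
            (definable_term_ren (fun i => S (S i)) Hw) _).
  exact (definable_ren (fun i => match i with O => 2 | 1 => 1 | _ => 0 end) H).
Qed.

Class Fun1 (F : M -> M) : Prop := fun1 : Def2 (fun y a => y = F a).
Class Fun2 (F : M -> M -> M) : Prop := fun2 : Def3 (fun y a b => y = F a b).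

Lemma definable_term_app1 (F : M -> M) (H : Fun1 F) u :
  definable_term u -> definable_term (fun e => F (u e)).
Proof.
  intro Hu.
  exact (definable_app2 (R := fun y a => y = F a) H
           (definable_term_var 0) (definable_term_ren S Hu)).
Qed.

Lemma definable_term_app2 (F : M -> M -> M) (H : Fun2 F) u v :
  definable_term u -> definable_term v -> definable_term (fun e => F (u e) (v e)).
Proof.
  intros Hu Hv.
  exact (definable_app3 (R := fun y a b => y = F a b) H
           (definable_term_var 0)
           (definable_term_ren S Hu) (definable_term_ren S Hv)).
Qed.

Global Instance def_mem : Def2 (@mem M E).
Proof. exact (definable_mem_var 0 1). Qed.

Global Instance def_eq : Def2 (@eq M).
Proof. exact (definable_eq_var 0 1). Qed.

End Definability.

(* [definable_binder] is a hook for the binding operators introduced later. *)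
Ltac definable_binder := fail.

Ltac definability :=
  cbv beta;
  lazymatch goal with
  | |- Def1 _ => unfold Def1; definability
  | |- Def2 _ => unfold Def2; definability
  | |- Def3 _ => unfold Def3; definability
  | |- Fun1 _ => unfold Fun1, Def2; definability
  | |- Fun2 _ => unfold Fun2, Def3; definability
  | |- definable (fun e => False) => apply definable_False
  | |- definable (fun e => ~ _) => apply definable_not; definability
  | |- definable (fun e => _ /\ _) => apply definable_and; definability
  | |- definable (fun e => _ \/ _) => apply definable_or; definability
  | |- definable (fun e => _ <-> _) => apply definable_iff; definability
  | |- definable (fun e => ex (unique _)) => unfold unique; definability
  | |- definable (fun e => unique _ _) => unfold unique; definability
  | |- definable (fun e => exists _, _) => apply definable_ex; definability
  | |- definable (fun e => @?P e -> @?Q e) =>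
      first [apply (@definable_imp _ _ P Q) | apply definable_all]; definability
  | |- definable (fun e => forall _, _) => apply definable_all; definability
  | |- definable_term (fun e => e _) => apply definable_term_var
  | |- _ => first [apply definable_term_const | definable_binder | definable_atom]
  end
with definable_atom :=
  match goal with
  | |- definable (fun e => ?R (@?u e)) =>
      notypeclasses refine (definable_app1 (R := R) _ (u := u) _);
      [typeclasses eauto | definability]
  | |- definable (fun e => ?R (@?u e) (@?v e)) =>
      notypeclasses refine (definable_app2 (R := R) _ (u := u) (v := v) _ _);
      [typeclasses eauto | definability | definability]
  | |- definable (fun e => ?R (@?u e) (@?v e) (@?w e)) =>
      notypeclasses refine (definable_app3 (R := R) _ (u := u) (v := v) (w := w) _ _ _);
      [typeclasses eauto | definability | definability | definability]
  | |- definable_term (fun e => ?F (@?u e)) =>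
      notypeclasses refine (definable_term_app1 (F := F) _ (u := u) _);
      [typeclasses eauto | definability]
  | |- definable_term (fun e => ?F (@?u e) (@?v e)) =>
      notypeclasses refine (definable_term_app2 (F := F) _ (u := u) (v := v) _ _);
      [typeclasses eauto | definability | definability]
  end.

Section DefinableNotions.
Context {M : Type} {E : SetStr M}.

Global Instance def_subset : Def2 (@subset M E).
Proof. unfold subset; definability. Qed.
Global Instance def_is_empty : Def1 (@is_empty M E).
Proof. unfold is_empty; definability. Qed.
Global Instance def_is_upair : Def3 (@is_upair M E).
Proof. unfold is_upair; definability. Qed.
Global Instance def_is_succ : Def2 (@is_succ M E).
Proof. unfold is_succ; definability. Qed.
Global Instance def_inductive_set : Def1 (@inductive_set M E).
Proof. unfold inductive_set; definability. Qed.
Global Instance def_is_nat : Def1 (@is_nat M E).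
Proof. unfold is_nat; definability. Qed.
Global Instance def_leq : Def2 (@leq M E).
Proof. unfold leq; definability. Qed.
Global Instance def_is_pair : Def3 (@is_pair M E).
Proof. unfold is_pair; definability. Qed.
Global Instance def_rel : Def3 (@rel M E).
Proof. unfold rel; definability. Qed.
Global Instance def_is_fun : Def2 (@is_fun M E).
Proof. unfold is_fun; definability. Qed.
Global Instance def_is_fun_to : Def3 (@is_fun_to M E).
Proof. unfold is_fun_to; definability. Qed.
Global Instance def_chain (R : M -> M -> Prop) (HR : Def2 R) : Def3 (chain R).
Proof. unfold chain; definability. Qed.
Global Instance def_seq_of_len : Def3 (@seq_of_len M E).
Proof. unfold seq_of_len; definability. Qed.
Global Instance def_finseq : Def2 (@finseq M E).
Proof. unfold finseq; definability. Qed.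

End DefinableNotions.

(** * Comprehension terms *)

Section Comprehension.
Context {M : Type} {E : SetStr M} {HZ : ZF M}.

Lemma ext (a b : M) : (forall z, z ∈ a <-> z ∈ b) -> a = b.
Proof. apply (ZF_extensionality HZ). Qed.

Lemma separation (P : M -> Prop) (a : M) : Def1 P ->
  exists b, forall z, z ∈ b <-> z ∈ a /\ P z.
Proof.
  intros (f & r & H).
  destruct (ZF_separation HZ
    (ren (fun i => match r i with inl O => O | _ => S i end) f)
    (fun i => match r i with inr c => c | _ => a end) a) as [b Hb].
  exists b; intro z; rewrite (Hb z), sat_ren.
  rewrite <- (H (scons z (fun _ => a))).
  apply and_iff_compat_l, sat_ext; intro i.
  destruct (r i) as [[|k]|c] eqn:Hr; simpl; rewrite ?Hr; reflexivity.
Qed.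

(** The hypothesis of the replacement axiom is automatic here, since the defining
    relation is the graph of a function of the metatheory. *)
Lemma replacement (F : M -> M) (a : M) : Fun1 F ->
  exists b, forall z, z ∈ b <-> exists y, y ∈ a /\ z = F y.
Proof.
  intros (f & r & H).
  set (g := ren (fun i => match r i with
                          | inl O => O | inl (S O) => 1 | _ => S (S i) end) f).
  set (c := fun i => match r i with inr c => c | _ => a end).
  assert (K : forall z y, sat g (scons z (scons y c)) <-> z = F y).
  { intros z y. unfold g; rewrite sat_ren.
    rewrite <- (H (scons z (scons y (fun _ => a)))).
    apply sat_ext; intro i; unfold c.
    destruct (r i) as [[|[|k]]|d] eqn:Hr; simpl; rewrite ?Hr; reflexivity. }
  destruct (ZF_replacement HZ (f := g) (e := c) (a := a)) as [b Hb].
  - intros y _; exists (F y); split; [apply K; reflexivity|].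
    intros z Hz; apply K in Hz; auto.
  - exists b; intro z; rewrite (Hb z).
    split; intros [y [Hy Hz]]; exists y; split; auto; apply K; auto.
Qed.

Lemma ZF_inhabited : inhabited M.
Proof. destruct (ZF_infinity HZ) as [w _]; exact (inhabits w). Qed.

(** The default value is the empty set, so that the graph of a described term is
    definable even where the description fails. *)
Definition the (P : M -> Prop) : M :=
  epsilon ZF_inhabited
    (fun y => unique P y \/ (~ (exists! y, P y)) /\ is_empty y).

Lemma the_graph (P : M -> Prop) y :
  y = the P <-> unique P y \/ (~ (exists! y, P y)) /\ is_empty y.
Proof.
  assert (H : exists y, unique P y \/ (~ (exists! y, P y)) /\ is_empty y).
  { destruct (classic (exists! y, P y)) as [[z Hz]|H]; [exists z; auto|].
    destruct (@separation (fun _ => False) y) as [b Hb]; [definability|].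
    exists b; right; split; auto; intros z Hz; apply Hb in Hz; tauto. }
  pose proof (epsilon_spec ZF_inhabited _ H) as K; fold (the P) in K.
  split; [intros ->; exact K|].
  intros [L|[L1 L2]]; destruct K as [K|[K1 K2]].
  - destruct L as [L1 L2], K as [K1 K2]; auto.
  - destruct K1; exists y; auto.
  - destruct L1; exists (the P); auto.
  - apply ext; intro z; split; intro Hz; [destruct (L2 z Hz)|destruct (K2 z Hz)].
Qed.

Lemma the_eq (P : M -> Prop) y : P y -> (forall z, P z -> z = y) -> the P = y.
Proof.
  intros H K; symmetry; apply the_graph; left; split; [exact H|].
  intros z Hz; symmetry; auto.
Qed.

Lemma definable_the (B : (nat -> M) -> M -> Prop) :
  definable (fun e => B (fun i => e (S i)) (e 0)) ->
  definable_term (fun e => the (B e)).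
Proof.
  intro H.
  assert (H0 : definable (fun e => B (fun i => e (S (S i))) (e 0))).
  { exact (definable_ren (fun i => match i with O => O | S i => S (S i) end) H). }
  assert (H1 : definable (fun e => B (fun i => e (S (S (S i)))) (e 0))).
  { exact (definable_ren (fun i => match i with O => O | S i => S (S (S i)) end) H). }
  refine (definable_ext
    (P := fun e => unique (B (fun i => e (S i))) (e 0) \/
       (~ (exists! y, B (fun i => e (S i)) y)) /\ is_empty (e 0)) _ _).
  { intro e; rewrite the_graph; tauto. }
  apply definable_or; [apply definable_and|apply definable_and].
  - exact H.
  - apply definable_all, definable_imp; [exact H0|definability].
  - apply definable_not. unfold unique. apply definable_ex, definable_and.
    + exact H0.
    + apply definable_all, definable_imp; [exact H1|definability].
  - definability.
Qed.

(** The set [{z | P z}], meaningful when this class is a set. *)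
Definition setof (P : M -> Prop) : M := the (fun b => forall z, z ∈ b <-> P z).

Lemma definable_setof (B : (nat -> M) -> M -> Prop) :
  definable (fun e => B (fun i => e (S i)) (e 0)) ->
  definable_term (fun e => setof (B e)).
Proof.
  intro H.
  apply (definable_the (B := fun e b => forall z, z ∈ b <-> B e z)).
  apply definable_all, definable_iff; [definability|].
  exact (definable_ren (fun i => match i with O => O | S i => S (S i) end) H).
Qed.

Lemma setof_eq (P : M -> Prop) b : (forall z, z ∈ b <-> P z) -> b = setof P.
Proof.
  intro H; symmetry; apply the_eq; [exact H|].
  intros c Hc; apply ext; intro z; rewrite H, Hc; tauto.
Qed.

Lemma in_setof_ex (P : M -> Prop) :
  (exists b, forall z, z ∈ b <-> P z) -> forall z, z ∈ setof P <-> P z.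
Proof. intros [b Hb]; rewrite <- (setof_eq Hb); exact Hb. Qed.

Lemma in_setof (P : M -> Prop) a : Def1 P -> (forall z, P z -> z ∈ a) ->
  forall z, z ∈ setof P <-> P z.
Proof.
  intros HP Ha; apply in_setof_ex.
  destruct (separation a HP) as [b Hb]; exists b; intro z; rewrite Hb.
  split; [tauto|]; auto.
Qed.

End Comprehension.

Ltac definable_binder ::=
  match goal with
  | |- definable_term (fun e => the (@?B e)) =>
      apply (definable_the (B := B)); definability
  | |- definable_term (fun e => setof (@?B e)) =>
      apply (definable_setof (B := B)); definability
  end.

(** * Basic sets *)

Section Basic.
Context {M : Type} {E : SetStr M} {HZ : ZF M}.
Implicit Types a b c f i k l m n p s t x y z A B X : M.

Definition emp : M := setof (fun _ => False).
Definition upair a b : M := setof (fun z => z = a \/ z = b).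
Definition pr a b : M := upair (upair a a) (upair a b).
Definition triple a b c : M := pr (pr a b) c.
Definition succ n : M := setof (fun z => z ∈ n \/ z = n).
Definition uni a : M := setof (fun z => exists y, y ∈ a /\ z ∈ y).
Definition cup a b : M := uni (upair a b).
Definition pow a : M := setof (fun z => subset z a).
Definition image (F : M -> M) a : M := setof (fun z => exists y, y ∈ a /\ z = F y).
(** Products come from replacement applied twice, which bounds them by definable
    operations only. *)
Definition prod A B : M := uni (image (fun a => image (fun b => pr a b) B) A).

Global Instance def_upair : Fun2 upair.
Proof. unfold upair; definability. Qed.
Global Instance def_pr : Fun2 pr.
Proof. unfold pr; definability. Qed.
Global Instance def_succ : Fun1 succ.
Proof. unfold succ; definability. Qed.

Lemma in_emp z : z ∈ emp <-> False.
Proof.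
  refine (in_setof (P := fun _ => False) (a := z) _ _ z); [definability|tauto].
Qed.

Lemma is_empty_emp a : is_empty a <-> a = emp.
Proof.
  split.
  - intro H; apply ext; intro z; rewrite in_emp; split; [apply H|tauto].
  - intros -> z; rewrite in_emp; tauto.
Qed.

Lemma in_upair a b z : z ∈ upair a b <-> z = a \/ z = b.
Proof. exact (in_setof_ex (ZF_pairing HZ a b) z). Qed.

Lemma is_upairE a b c : is_upair a b c <-> c = upair a b.
Proof.
  split; [apply setof_eq | intros -> z; apply in_upair].
Qed.

Lemma is_pairE a b p : is_pair a b p <-> p = pr a b.
Proof.
  unfold is_pair; split.
  - intros (u & v & Hu & Hv & Hp); rewrite is_upairE in *; subst; reflexivity.
  - intros ->; exists (upair a a), (upair a b); rewrite !is_upairE; auto.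
Qed.

Lemma pr_inj a b a' b' : pr a b = pr a' b' -> a = a' /\ b = b'.
Proof.
  unfold pr; intro H.
  assert (K : forall z, z = upair a a \/ z = upair a b <->
                   z = upair a' a' \/ z = upair a' b').
  { intro z; rewrite <- !in_upair, H; tauto. }
  assert (U : forall a b c d, upair a b = upair c d ->
      (a = c \/ a = d) /\ (b = c \/ b = d) /\ (c = a \/ c = b) /\ (d = a \/ d = b)).
  { clear; intros a b c d H.
    rewrite <- (in_upair c d a), <- (in_upair c d b), <- H, !in_upair.
    rewrite <- (in_upair a b c), <- (in_upair a b d), H, !in_upair; tauto. }
  assert (a = a').
  { destruct (proj1 (K (upair a a))) as [L|L]; auto; apply U in L; intuition congruence. }
  subst a'; split; [reflexivity|].
  destruct (proj1 (K (upair a b))) as [L|L]; auto; apply U in L;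
  destruct (proj2 (K (upair a b'))) as [L'|L']; auto; apply U in L'.
  - destruct L as (_ & [L|L] & _), L' as (_ & [L'|L'] & _); congruence.
  - destruct L as (_ & [L|L] & _), L' as (_ & [L'|L'] & _); congruence.
  - destruct L as (_ & [L|L] & _), L' as (_ & [L'|L'] & _); congruence.
  - destruct L as (_ & [L|L] & _), L' as (_ & [L'|L'] & _); congruence.
Qed.

Lemma is_tripleE a b c p : is_triple a b c p <-> p = triple a b c.
Proof.
  unfold is_triple; split.
  - intros (q & Hq & Hp); rewrite is_pairE in *; subst; reflexivity.
  - intros ->; exists (pr a b); rewrite !is_pairE; auto.
Qed.

Lemma triple_inj a b c a' b' c' :
  triple a b c = triple a' b' c' -> a = a' /\ b = b' /\ c = c'.
Proof.
  intro H; apply pr_inj in H; destruct H as [H ->]; apply pr_inj in H; tauto.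
Qed.

Lemma in_uni a z : z ∈ uni a <-> exists y, y ∈ a /\ z ∈ y.
Proof. exact (in_setof_ex (ZF_union HZ a) z). Qed.

Lemma in_pow a z : z ∈ pow a <-> subset z a.
Proof. exact (in_setof_ex (ZF_powerset HZ a) z). Qed.

Lemma in_cup a b z : z ∈ cup a b <-> z ∈ a \/ z ∈ b.
Proof.
  unfold cup; rewrite in_uni; split.
  - intros (y & Hy & Hz); apply in_upair in Hy; destruct Hy; subst; auto.
  - intros [H|H]; [exists a|exists b]; rewrite in_upair; auto.
Qed.

Lemma in_succ n z : z ∈ succ n <-> z ∈ n \/ z = n.
Proof.
  refine (in_setof_ex (P := fun z => z ∈ n \/ z = n) _ z).
  exists (cup n (upair n n)); intro y.
  rewrite in_cup, in_upair; tauto.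
Qed.

Lemma is_succE n s : is_succ n s <-> s = succ n.
Proof. split; [apply setof_eq|intros -> z; apply in_succ]. Qed.

Lemma in_image (F : M -> M) a z : Fun1 F ->
  z ∈ image F a <-> exists y, y ∈ a /\ z = F y.
Proof. intro HF; exact (in_setof_ex (replacement a HF) z). Qed.

Lemma in_prod A B z : z ∈ prod A B <-> exists a b, a ∈ A /\ b ∈ B /\ z = pr a b.
Proof.
  assert (H : forall a, Fun1 (fun b => pr a b)) by (intro a; definability).
  assert (H' : Fun1 (fun a => image (fun b => pr a b) B)).
  { unfold image; definability. }
  unfold prod; rewrite in_uni; split.
  - intros (y & Hy & Hz); apply in_image in Hy; [|exact H'].
    destruct Hy as (a & Ha & ->); apply in_image in Hz; [|apply H].
    destruct Hz as (b & Hb & ->); eauto.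
  - intros (a & b & Ha & Hb & ->).
    exists (image (fun b => pr a b) B); split.
    + apply in_image; [exact H'|eauto].
    + apply in_image; [apply H|eauto].
Qed.

Lemma relE f a b : rel f a b <-> pr a b ∈ f.
Proof.
  split.
  - intros (p & Hp & H); apply is_pairE in Hp; subst; exact H.
  - intro H; exists (pr a b); rewrite is_pairE; auto.
Qed.

Lemma rel_bound f a b : rel f a b -> a ∈ uni (uni f) /\ b ∈ uni (uni f).
Proof.
  intro H; apply relE in H; split; apply in_uni; exists (upair a b);
    (split; [|apply in_upair; auto]); apply in_uni; exists (pr a b);
    (split; [exact H|apply in_upair; auto]).
Qed.

Lemma notin_self a : ~ a ∈ a.
Proof.
  intro H; destruct (ZF_foundation HZ (a := upair a a)) as (z & Hz & K).
  - exists a; apply in_upair; auto.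
  - apply in_upair in Hz; apply K; exists a; rewrite in_upair.
    destruct Hz; subst; auto.
Qed.

End Basic.

(** * Natural numbers and internal recursion *)

Section Induction.
Context {M : Type} {E : SetStr M} {HZ : ZF M}.
Implicit Types a b c d f i k l m n p s t x y z A B X : M.

Lemma inductiveE w : inductive_set w <->
  emp ∈ w /\ forall n, n ∈ w -> succ n ∈ w.
Proof.
  split.
  - intros [(e & He & Hw) H]; apply is_empty_emp in He; subst e; split; auto.
    intros n Hn; destruct (H n Hn) as (s & Hs & K); apply is_succE in Hs; subst; auto.
  - intros [H0 H]; split; [exists emp; rewrite is_empty_emp; auto|].
    intros n Hn; exists (succ n); rewrite is_succE; auto.
Qed.

Lemma nat_0 : is_nat emp.
Proof. intros w Hw; apply inductiveE in Hw; tauto. Qed.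

Lemma nat_S n : is_nat n -> is_nat (succ n).
Proof. intros H w Hw; pose proof (H w Hw); apply inductiveE in Hw; apply Hw; auto. Qed.

Definition om : M := setof is_nat.

Lemma in_om n : n ∈ om <-> is_nat n.
Proof.
  destruct (ZF_infinity HZ) as [w Hw].
  apply (in_setof (a := w)); [exact def_is_nat|intros z Hz; apply Hz; auto].
Qed.

Lemma is_omegaE w : is_omega w <-> w = om.
Proof. split; [apply setof_eq|intros -> n; apply in_om]. Qed.

Lemma omega_ind (P : M -> Prop) : Def1 P ->
  P emp -> (forall n, is_nat n -> P n -> P (succ n)) -> forall n, is_nat n -> P n.
Proof.
  intros HP H0 HS n Hn; destruct (separation om HP) as [b Hb].
  apply (Hb n), Hn, inductiveE; split.
  - apply Hb; rewrite in_om; split; [apply nat_0|auto].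
  - intros m Hm; apply Hb in Hm; rewrite in_om in Hm; apply Hb; rewrite in_om.
    split; [apply nat_S|apply HS]; tauto.
Qed.

End Induction.

Ltac nat_induction :=
  match goal with
  | |- forall n, is_nat n -> @?P n => apply (omega_ind (P := P)); cbv beta
  end.

Section Numbers.
Context {M : Type} {E : SetStr M} {HZ : ZF M}.
Implicit Types a b c d f i k l m n p s t x y z A B X : M.

Lemma nat_cases n : is_nat n -> n = emp \/ exists m, is_nat m /\ n = succ m.
Proof.
  revert n; nat_induction; [definability|auto|].
  intros n Hn _; right; exists n; auto.
Qed.

Lemma nat_down n : is_nat n -> forall i, i ∈ n -> is_nat i /\ subset i n.
Proof.
  revert n; nat_induction; [definability| |].
  - intros i Hi; apply in_emp in Hi; tauto.
  - intros n Hn IH i Hi; apply in_succ in Hi; destruct Hi as [Hi| ->].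
    + destruct (IH i Hi) as [K L]; split; auto; intros z Hz; apply in_succ; left; auto.
    + split; auto; intros z Hz; apply in_succ; auto.
Qed.

Lemma nat_asym n i : is_nat n -> i ∈ n -> ~ n ∈ i.
Proof.
  intros Hn Hi H; apply (notin_self (a := n)); exact (proj2 (nat_down Hn Hi) n H).
Qed.

Lemma succ_inj m n : is_nat m -> is_nat n -> succ m = succ n -> m = n.
Proof.
  intros Hm Hn H.
  assert (K : m ∈ succ n) by (rewrite <- H; apply in_succ; auto).
  assert (L : n ∈ succ m) by (rewrite H; apply in_succ; auto).
  apply in_succ in K, L; destruct K as [K|K]; auto; destruct L as [L|L]; auto.
  destruct (nat_asym Hm L K).
Qed.

Lemma succ_not_0 n : succ n <> emp.
Proof.
  intro H; apply (in_emp n); rewrite <- H; apply in_succ; auto.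
Qed.

Definition restr x k : M :=
  setof (fun p => p ∈ x /\ exists i b, i ∈ k /\ is_pair i b p).

Lemma in_restr x k p :
  p ∈ restr x k <-> p ∈ x /\ exists i b, i ∈ k /\ p = pr i b.
Proof.
  assert (H : p ∈ restr x k <-> p ∈ x /\ exists i b, i ∈ k /\ is_pair i b p).
  { refine (in_setof (P := fun p => p ∈ x /\ exists i b, i ∈ k /\ is_pair i b p)
             (a := x) _ _ p); [definability|tauto]. }
  rewrite H; split; intros [K (i & b & L & N)]; split; auto; exists i, b; split; auto;
    apply is_pairE; auto.
Qed.

Lemma is_restrE x k s : is_restr x k s <-> s = restr x k.
Proof.
  split; [apply setof_eq|].
  intros -> p; rewrite in_restr.
  split; intros [K (i & b & L & N)]; split; auto; exists i, b; split; auto;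
    apply is_pairE; auto.
Qed.

Lemma rel_restr x k i b : rel (restr x k) i b <-> rel x i b /\ i ∈ k.
Proof.
  rewrite !relE, in_restr; split.
  - intros [H (i' & b' & K & L)]; apply pr_inj in L; destruct L; subst; auto.
  - intros [H K]; split; auto; exists i, b; auto.
Qed.

(** [chain_0] and [chain_S] are the recursion equations of chains. They replace
    the recursion theorem: addition and iterated extension are handled through
    them alone. *)
Lemma chain_0 (R : M -> M -> Prop) a b : chain R a emp b <-> a = b.
Proof.
  split.
  - intros (f & N & HN & Hf & (e & He & Ha) & Hb & _).
    apply is_empty_emp in He; subst e; apply is_succE in HN; subst N.
    destruct Hf as [_ Hf]; destruct (Hf emp) as (c & _ & Hc).
    + apply in_succ; auto.
    + rewrite <- (Hc a Ha), <- (Hc b Hb); reflexivity.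
  - intros <-. exists (upair (pr emp a) (pr emp a)), (succ emp).
    assert (K : forall i b, rel (upair (pr emp a) (pr emp a)) i b <-> i = emp /\ b = a).
    { intros i b; rewrite relE, in_upair; split.
      - intros [H|H]; apply pr_inj in H; auto.
      - intros [-> ->]; auto. }
    split; [apply is_succE; auto|]; split; [split|split; [|split]].
    + intros p Hp; exists emp, a; rewrite is_pairE, in_succ.
      apply in_upair in Hp; destruct Hp; auto.
    + intros i Hi; apply in_succ in Hi; destruct Hi as [Hi| ->].
      * apply in_emp in Hi; tauto.
      * exists a; split; [apply K; auto|]; intros c Hc; apply K in Hc; symmetry; tauto.
    + exists emp; rewrite is_empty_emp; split; auto; apply K; auto.
    + apply K; auto.
    + intros i i' u v Hi; apply in_emp in Hi; tauto.
Qed.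

Lemma chain_S (R : M -> M -> Prop) a n c : is_nat n ->
  chain R a (succ n) c <-> exists b, chain R a n b /\ R b c.
Proof.
  intro Hn; split.
  - intros (f & N & HN & [Hf1 Hf2] & (e & He & Ha) & Hc & HR).
    apply is_empty_emp in He; subst e; apply is_succE in HN; subst N.
    destruct (Hf2 n) as (b & Hb & _).
    { rewrite !in_succ; auto. }
    exists b; split.
    + exists (restr f (succ n)), (succ n); split; [apply is_succE; auto|].
      assert (K : forall i, i ∈ succ n -> i ∈ succ (succ n)).
      { intros i Hi; apply in_succ; auto. }
      split; [split|split; [|split]].
      * intros p Hp; apply in_restr in Hp; destruct Hp as [_ (i & d & Hi & ->)].
        exists i, d; rewrite is_pairE; auto.
      * intros i Hi; destruct (Hf2 i (K i Hi)) as (d & Hd & Hd').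
        exists d; split; [apply rel_restr; auto|].
        intros d' H; apply rel_restr in H; apply Hd'; tauto.
      * exists emp; rewrite is_empty_emp, rel_restr; split; auto; split; auto.
        destruct (nat_cases Hn) as [->|(m & Hm & ->)]; rewrite !in_succ; auto.
        left; clear - Hm; revert m Hm; nat_induction.
        -- definability.
        -- auto.
        -- intros m _ H; rewrite in_succ; auto.
      * apply rel_restr; rewrite in_succ; auto.
      * intros i i' u v Hi Hi' Hu Hv; apply rel_restr in Hu, Hv.
        apply (HR i i'); [apply in_succ|..]; tauto.
    + apply (HR n (succ n)); auto; [apply in_succ; auto|apply is_succE; auto].
  - intros (b & (f & N & HN & [Hf1 Hf2] & (e & He & Ha) & Hb & HR) & Hbc).
    apply is_empty_emp in He; subst e; apply is_succE in HN; subst N.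
    set (q := pr (succ n) c).
    assert (K : forall i d, rel (cup f (upair q q)) i d <->
                  rel f i d \/ i = succ n /\ d = c).
    { intros i d; rewrite !relE, in_cup, in_upair; unfold q; split.
      - intros [H|H]; auto; right; destruct H as [H|H]; apply pr_inj in H; auto.
      - intros [H|[-> ->]]; auto. }
    assert (L : forall i d, rel f i d -> i ∈ succ n).
    { intros i d H; apply relE in H; destruct (Hf1 _ H) as (i' & d' & H' & Hi).
      apply is_pairE, pr_inj in H'; destruct H'; subst; auto. }
    exists (cup f (upair q q)), (succ (succ n)).
    split; [apply is_succE; auto|split; [split|split; [|split]]].
    + intros p Hp; apply in_cup in Hp; destruct Hp as [Hp|Hp].
      * destruct (Hf1 p Hp) as (i & d & H & Hi); exists i, d; rewrite in_succ; auto.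
      * exists (succ n), c; rewrite is_pairE, in_succ; apply in_upair in Hp.
        destruct Hp; auto.
    + intros i Hi; apply in_succ in Hi; destruct Hi as [Hi| ->].
      * destruct (Hf2 i Hi) as (d & Hd & Hd'); exists d; split; [apply K; auto|].
        intros d' H; apply K in H; destruct H as [H|[-> ->]]; auto.
        destruct (notin_self Hi).
      * exists c; split; [apply K; auto|].
        intros d H; apply K in H; destruct H as [H|[_ ->]]; auto.
        destruct (notin_self (L _ _ H)).
    + exists emp; rewrite is_empty_emp, K; auto.
    + apply K; auto.
    + intros i i' u v Hi Hi' Hu Hv; apply is_succE in Hi'; subst i'.
      assert (Hu' : rel f i u).
      { apply K in Hu; destruct Hu as [Hu|[-> _]]; auto; destruct (notin_self Hi). }
      apply K in Hv; destruct Hv as [Hv|[Hv ->]].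
      * apply (HR i (succ i)); auto; [|apply is_succE; auto].
        pose proof (L _ _ Hv) as H.
        apply in_succ in Hi; destruct Hi as [Hi| ->]; [auto|].
        destruct (notin_self H).
      * assert (i = n); [|subst i].
        { apply succ_inj; auto; apply (nat_down (nat_S Hn) Hi). }
        destruct (Hf2 n) as (d & _ & Hd); [apply in_succ; auto|].
        rewrite <- (Hd u Hu'), (Hd b Hb); auto.
Qed.

(** ** Addition *)

Definition add m n : M := the (fun k => is_add m n k).

Global Instance def_add : Fun2 add.
Proof. unfold add; definability. Qed.

Lemma is_addE m n k : is_nat n -> is_add m n k <-> k = add m n.
Proof.
  intro Hn.
  assert (H : exists! k, is_add m n k).
  { unfold is_add; revert n Hn; nat_induction; [definability| |].
    - exists m; split; [apply chain_0; auto|]; intros l Hl; apply chain_0 in Hl; auto.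
    - intros n Hn (l & Hl & Hl'); exists (succ l); split.
      + apply chain_S; auto; exists l; rewrite is_succE; auto.
      + intros l' H; apply chain_S in H; auto; destruct H as (l2 & H & K).
        apply is_succE in K; rewrite K, (Hl' l2); auto. }
  destruct H as (l & Hl & Hl').
  assert (K : add m n = l) by (apply the_eq; auto; intros z Hz; symmetry; auto).
  rewrite K; split; [intro L; symmetry; auto|intros ->; auto].
Qed.

Lemma add_0 m : add m emp = m.
Proof. symmetry; apply is_addE; [apply nat_0|apply chain_0; auto]. Qed.

Lemma add_S m n : is_nat n -> add m (succ n) = succ (add m n).
Proof.
  intro Hn; symmetry; apply is_addE; [apply nat_S; auto|].
  apply chain_S; auto; exists (add m n); split; [apply is_addE; auto|apply is_succE; auto].
Qed.

Lemma nat_add m n : is_nat m -> is_nat n -> is_nat (add m n).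
Proof.
  intro Hm; revert n; nat_induction; [definability| |].
  - rewrite add_0; auto.
  - intros n Hn IH; rewrite add_S; auto; apply nat_S; auto.
Qed.

Lemma add_assoc a b c : is_nat b -> is_nat c -> add (add a b) c = add a (add b c).
Proof.
  intro Hb; revert c; nat_induction; [definability| |].
  - rewrite !add_0; auto.
  - intros n Hn IH; rewrite !add_S, IH; auto; apply nat_add; auto.
Qed.

Lemma add_0_l n : is_nat n -> add emp n = n.
Proof.
  revert n; nat_induction; [definability|apply add_0|].
  intros n Hn IH; rewrite add_S, IH; auto.
Qed.

Lemma add_S_l m n : is_nat n -> add (succ m) n = succ (add m n).
Proof.
  revert n; nat_induction; [definability|rewrite !add_0; auto|].
  intros n Hn IH; rewrite !add_S, IH; auto.
Qed.

Lemma add_cancel m i i' : is_nat m -> is_nat i -> is_nat i' ->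
  add m i = add m i' -> i = i'.
Proof.
  intros Hm Hi Hi'; revert m Hm; nat_induction; [definability| |].
  - rewrite !add_0_l; auto.
  - intros m Hm IH; rewrite !add_S_l; auto; intro H; apply IH, succ_inj; auto;
      apply nat_add; auto.
Qed.

Lemma add_cases m n : is_nat m -> is_nat n ->
  (exists d, is_nat d /\ n = add m d) \/ (exists d, is_nat d /\ m = add n (succ d)).
Proof.
  intro Hm; revert n; nat_induction; [definability| |].
  - destruct (nat_cases Hm) as [->|(d & Hd & ->)].
    + left; exists emp; rewrite add_0; split; [apply nat_0|auto].
    + right; exists d; rewrite add_0_l; auto; apply nat_S; auto.
  - intros n Hn [(d & Hd & ->)|(d & Hd & ->)].
    + left; exists (succ d); rewrite add_S; auto; split; auto; apply nat_S; auto.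
    + destruct (nat_cases Hd) as [->|(d' & Hd' & ->)].
      * left; exists emp; rewrite add_0, add_S, add_0; auto.
      * right; exists d'; split; auto; rewrite add_S_l, add_S; auto; apply nat_S; auto.
Qed.

Lemma lt_add_S m d : is_nat m -> is_nat d -> m ∈ add m (succ d).
Proof.
  intro Hm; revert d; nat_induction; [definability| |].
  - rewrite add_S, add_0; [apply in_succ; auto|apply nat_0].
  - intros d Hd IH; rewrite add_S; [apply in_succ; auto|apply nat_S; auto].
Qed.

Lemma lt_iff m n : is_nat m -> is_nat n ->
  m ∈ n <-> exists d, is_nat d /\ n = add m (succ d).
Proof.
  intros Hm Hn; split.
  - intro H; destruct (add_cases Hn Hm) as [(d & Hd & K)|K]; auto.
    destruct (nat_cases Hd) as [->|(d' & Hd' & ->)].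
    + rewrite add_0 in K; subst; destruct (notin_self H).
    + destruct (nat_asym Hn H); rewrite K; apply lt_add_S; auto.
  - intros (d & Hd & ->); apply lt_add_S; auto.
Qed.

Lemma leq_iff m n : is_nat m -> is_nat n ->
  leq m n <-> exists d, is_nat d /\ n = add m d.
Proof.
  intros Hm Hn; unfold leq; rewrite lt_iff; auto; split.
  - intros [(d & Hd & K)| ->].
    + exists (succ d); split; auto; apply nat_S; auto.
    + exists emp; rewrite add_0; split; [apply nat_0|auto].
  - intros (d & Hd & ->); destruct (nat_cases Hd) as [->|(d' & Hd' & ->)]; eauto.
    rewrite add_0; auto.
Qed.

Lemma add_lt m i n : is_nat m -> is_nat i -> is_nat n ->
  add m i ∈ add m n <-> i ∈ n.
Proof.
  intros Hm Hi Hn; rewrite !lt_iff; auto using nat_add; split.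
  - intros (d & Hd & K); exists d; split; auto.
    rewrite add_assoc in K; auto using nat_S.
    apply add_cancel in K; auto using nat_S, nat_add.
  - intros (d & Hd & ->); exists d; split; auto; rewrite add_assoc; auto using nat_S.
Qed.

Lemma add_not_lt m i : is_nat m -> is_nat i -> ~ add m i ∈ m.
Proof.
  intros Hm Hi H; rewrite <- (add_0 m) in H at 2.
  apply add_lt in H; auto using nat_0; apply in_emp in H; auto.
Qed.

(** Foundation provides a minimal element; this also holds when the naturals of
    the structure are nonstandard. *)
Lemma least_nat (P : M -> Prop) : Def1 P -> (exists n, is_nat n /\ P n) ->
  exists! n, is_nat n /\ P n /\ forall m, m ∈ n -> ~ P m.
Proof.
  intros HP (n & Hn & H).
  destruct (separation om HP) as [b Hb].
  destruct (ZF_foundation HZ (a := b)) as (z & Hz & K).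
  { exists n; apply Hb; rewrite in_om; auto. }
  apply Hb in Hz; rewrite in_om in Hz; destruct Hz as [Hz Pz].
  assert (Kz : forall m, m ∈ z -> ~ P m).
  { intros m Hm Pm; apply K; exists m; split; auto; apply Hb; rewrite in_om.
    split; auto; apply (nat_down Hz Hm). }
  exists z; split; [auto|].
  intros y (Hy & Py & Ky).
  destruct (add_cases Hz Hy) as [(d & Hd & L)|(d & Hd & L)].
  - destruct (nat_cases Hd) as [->|(d' & Hd' & ->)]; [rewrite add_0 in L; auto|].
    destruct (Ky z); auto; rewrite L; apply lt_add_S; auto.
  - destruct (Kz y); auto; rewrite L; apply lt_add_S; auto.
Qed.

End Numbers.

(** * Sequences *)

Section Sequences.
Context {M : Type} {E : SetStr M} {HZ : ZF M}.
Implicit Types a b c d f i k l m n p s t u v x y z A B X : M.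

Definition dom s : M := setof (fun i => exists b, rel s i b).
Definition single a : M := upair (pr emp a) (pr emp a).
Definition cat s t : M :=
  setof (fun p => p ∈ s \/
    exists i l b, rel t i b /\ is_add (dom s) i l /\ is_pair l b p).
Definition tail x k : M :=
  setof (fun p => exists i l b, is_nat i /\ is_add k i l /\ rel x l b /\ is_pair i b p).
Definition Fin X : M := setof (finseq X).

Global Instance def_dom : Fun1 dom.
Proof. unfold dom; definability. Qed.
Global Instance def_single : Fun1 single.
Proof. unfold single; definability. Qed.
Global Instance def_cat : Fun2 cat.
Proof. unfold cat; definability. Qed.

(** Finite and infinite sequences are treated together as sets of pairs with
    natural first components. *)
Definition indexed s : Prop := forall p, p ∈ s -> exists i b, is_nat i /\ p = pr i b.

Lemma rel_nat s i b : indexed s -> rel s i b -> is_nat i.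
Proof.
  intros H K; apply relE in K; destruct (H _ K) as (i' & b' & Hi & L).
  apply pr_inj in L; destruct L; subst; auto.
Qed.

Lemma seq_ext s t : indexed s -> indexed t ->
  (forall i b, is_nat i -> rel s i b <-> rel t i b) -> s = t.
Proof.
  intros Hs Ht H; apply ext; intro p; split; intro Hp.
  - destruct (Hs p Hp) as (i & b & Hi & ->); apply relE, H; auto; apply relE; auto.
  - destruct (Ht p Hp) as (i & b & Hi & ->); apply relE, H; auto; apply relE; auto.
Qed.

Lemma in_dom s i : i ∈ dom s <-> exists b, rel s i b.
Proof.
  refine (in_setof (P := fun i => exists b, rel s i b) (a := uni (uni s)) _ _ i).
  - definability.
  - intros z [b Hb]; apply rel_bound in Hb; tauto.
Qed.

Lemma is_domE s n : is_dom s n <-> n = dom s.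
Proof. split; [apply setof_eq|intros -> i; apply in_dom]. Qed.

Lemma in_tail x k p :
  p ∈ tail x k <-> exists i b, is_nat i /\ rel x (add k i) b /\ p = pr i b.
Proof.
  assert (H : forall p, (exists i l b, is_nat i /\ is_add k i l /\ rel x l b /\ is_pair i b p)
     <-> exists i b, is_nat i /\ rel x (add k i) b /\ p = pr i b).
  { clear p; intro p; split.
    - intros (i & l & b & Hi & Hl & Hb & Hp); exists i, b.
      rewrite is_addE in Hl; auto; rewrite is_pairE in Hp; subst; auto.
    - intros (i & b & Hi & Hb & ->); exists i, (add k i), b.
      rewrite is_addE, is_pairE; auto. }
  rewrite <- H; refine (in_setof (P := fun p => exists i l b,
    is_nat i /\ is_add k i l /\ rel x l b /\ is_pair i b p)
    (a := prod om (uni (uni x))) _ _ p).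
  - definability.
  - intros z Hz; apply H in Hz; destruct Hz as (i & b & Hi & Hb & ->).
    apply in_prod; exists i, b; rewrite in_om; apply rel_bound in Hb; tauto.
Qed.

Lemma is_tailE x k y : is_tail x k y <-> y = tail x k.
Proof.
  split; [apply setof_eq|]; intros -> p; rewrite in_tail; split.
  - intros (i & b & Hi & Hb & ->); exists i, (add k i), b.
    rewrite is_addE, is_pairE; auto.
  - intros (i & l & b & Hi & Hl & Hb & Hp); exists i, b.
    rewrite is_addE in Hl; auto; rewrite is_pairE in Hp; subst; auto.
Qed.

Lemma rel_tail x k i b : rel (tail x k) i b <-> is_nat i /\ rel x (add k i) b.
Proof.
  rewrite (relE (tail x k)), in_tail; split.
  - intros (i' & b' & Hi & Hb & K); apply pr_inj in K; destruct K; subst; auto.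
  - intros [Hi Hb]; exists i, b; auto.
Qed.

Lemma indexed_tail x k : indexed (tail x k).
Proof. intros p Hp; apply in_tail in Hp; destruct Hp as (i & b & ? & ? & ?); eauto. Qed.

Lemma indexed_restr x k : indexed x -> indexed (restr x k).
Proof. intros H p Hp; apply H; apply in_restr in Hp; tauto. Qed.

Lemma rel_single a i b : rel (single a) i b <-> i = emp /\ b = a.
Proof.
  unfold single; rewrite relE, in_upair; split.
  - intros [H|H]; apply pr_inj in H; auto.
  - intros [-> ->]; auto.
Qed.

Lemma is_singleE a t : is_single a t <-> t = single a.
Proof.
  unfold is_single, single; split.
  - intros (e & p & He & Hp & Ht); apply is_empty_emp in He; subst e.
    apply is_pairE in Hp; subst p; apply is_upairE in Ht; auto.
  - intros ->; exists emp, (pr emp a); rewrite is_empty_emp, is_pairE, is_upairE; auto.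
Qed.

(** The length of a finite sequence is its domain, so it need not be carried along
    as a separate parameter. *)
Lemma finseqE X s : finseq X s <->
  indexed s /\ is_nat (dom s) /\ (forall i b b', rel s i b -> rel s i b' -> b = b') /\
  (forall i b, rel s i b -> b ∈ X).
Proof.
  split.
  - intros (n & Hn & [H1 H2] & H3).
    assert (H4 : forall i b, rel s i b -> i ∈ n).
    { intros i b H; apply relE in H; destruct (H1 _ H) as (i' & b' & Hp & Hi).
      apply is_pairE, pr_inj in Hp; destruct Hp; subst; auto. }
    assert (Hd : dom s = n).
    { apply ext; intro i; rewrite in_dom; split; [intros [b Hb]; eauto|].
      intro Hi; destruct (H2 i Hi) as (b & Hb & _); eauto. }
    split; [|split; [rewrite Hd; auto|split; auto]].
    + intros p Hp; destruct (H1 p Hp) as (i & b & Hib & Hi); exists i, b.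
      rewrite <- is_pairE; split; auto; apply (nat_down Hn Hi).
    + intros i b b' Hb Hb'; destruct (H2 i (H4 _ _ Hb)) as (c & _ & Hc).
      rewrite <- (Hc b Hb), (Hc b'); auto.
  - intros (Hi & Hn & Hf & HX); exists (dom s); split; auto; split; auto; split.
    + intros p Hp; destruct (Hi p Hp) as (i & b & _ & ->); exists i, b.
      rewrite is_pairE, in_dom; split; auto; exists b; apply relE; auto.
    + intros i K; apply in_dom in K; destruct K as [b Hb]; exists b; split; eauto.
Qed.

Lemma seq_of_lenE X n s : seq_of_len X n s <-> finseq X s /\ n = dom s.
Proof.
  assert (K : forall m, seq_of_len X m s -> m = dom s).
  { intros m (Hm & [H1 H2] & _).
    apply ext; intro i; rewrite in_dom; split.
    - intro Hi; destruct (H2 i Hi) as (b & Hb & _); eauto.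
    - intros [b Hb]; apply relE in Hb; destruct (H1 _ Hb) as (i' & b' & Hp & Hi).
      apply is_pairE, pr_inj in Hp; destruct Hp; subst; auto. }
  split.
  - intro H; split; [exists n; exact H|auto].
  - intros [(m & H) ->]; rewrite <- (K m H); exact H.
Qed.

Lemma fin_indexed X s : finseq X s -> indexed s.
Proof. intro H; apply finseqE in H; tauto. Qed.

Lemma fin_nat X s : finseq X s -> is_nat (dom s).
Proof. intro H; apply finseqE in H; tauto. Qed.

Lemma fin_fun X s i b b' : finseq X s -> rel s i b -> rel s i b' -> b = b'.
Proof. intro H; apply finseqE in H; destruct H as (_ & _ & H & _); apply H. Qed.

Lemma fin_val X s i b : finseq X s -> rel s i b -> b ∈ X.
Proof. intro H; apply finseqE in H; destruct H as (_ & _ & _ & H); apply H. Qed.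

Lemma in_Fin X s : s ∈ Fin X <-> finseq X s.
Proof.
  apply (in_setof (a := pow (prod om X))); [unfold Def1; definability|].
  intros t Ht; apply in_pow; intros p Hp; apply in_prod.
  destruct (fin_indexed Ht Hp) as (i & b & Hi & ->); exists i, b; rewrite in_om.
  split; auto; split; auto; apply (fin_val (i := i) Ht), relE; auto.
Qed.

Lemma rel_emp i b : ~ rel emp i b.
Proof. rewrite relE, in_emp; auto. Qed.

Lemma dom_emp : dom emp = emp.
Proof.
  apply is_empty_emp; intros i Hi; apply in_dom in Hi; destruct Hi as [b Hb].
  destruct (rel_emp Hb).
Qed.

Lemma dom_0 X s : finseq X s -> dom s = emp -> s = emp.
Proof.
  intros Hs H; apply is_empty_emp; intros p Hp.
  destruct (fin_indexed Hs Hp) as (i & b & Hi & ->).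
  apply (in_emp i); rewrite <- H; apply in_dom; exists b; apply relE; auto.
Qed.

Lemma fin_emp X : finseq X emp.
Proof.
  apply finseqE; rewrite dom_emp; split; [|split; [apply nat_0|split]].
  - intros p Hp; apply in_emp in Hp; tauto.
  - intros i b b' H; destruct (rel_emp H).
  - intros i b H; destruct (rel_emp H).
Qed.

Lemma dom_single a : dom (single a) = succ emp.
Proof.
  apply ext; intro i; rewrite in_dom, in_succ, in_emp; split.
  - intros [b Hb]; apply rel_single in Hb; tauto.
  - intros [[]| ->]; exists a; apply rel_single; auto.
Qed.

Lemma indexed_single a : indexed (single a).
Proof.
  intros p Hp; exists emp, a; split; [apply nat_0|].
  apply in_upair in Hp; destruct Hp; auto.
Qed.

Lemma fin_single X a : a ∈ X -> finseq X (single a).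
Proof.
  intro Ha; apply finseqE; rewrite dom_single.
  split; [apply indexed_single|split; [apply nat_S, nat_0|split]].
  - intros i b b' H H'; apply rel_single in H, H'; destruct H, H'; subst; auto.
  - intros i b H; apply rel_single in H; destruct H; subst; auto.
Qed.

Lemma single_inj a b : single a = single b -> a = b.
Proof.
  intro H; assert (K : rel (single a) emp a) by (apply rel_single; auto).
  rewrite H in K; apply rel_single in K; tauto.
Qed.

(** ** Concatenation *)

Lemma in_cat s t p : is_nat (dom s) -> indexed t ->
  p ∈ cat s t <-> p ∈ s \/ exists i b, is_nat i /\ rel t i b /\ p = pr (add (dom s) i) b.
Proof.
  intros Hs Ht.
  assert (H : forall p,
    (exists i l b, rel t i b /\ is_add (dom s) i l /\ is_pair l b p) <->
    exists i b, is_nat i /\ rel t i b /\ p = pr (add (dom s) i) b).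
  { clear p; intro p; split.
    - intros (i & l & b & Hb & Hl & Hp); pose proof (rel_nat Ht Hb) as Hi.
      exists i, b; rewrite is_addE in Hl; auto; rewrite is_pairE in Hp; subst; auto.
    - intros (i & b & Hi & Hb & ->); exists i, (add (dom s) i), b.
      rewrite is_addE, is_pairE; auto. }
  rewrite <- H.
  refine (in_setof (P := fun p => p ∈ s \/
    exists i l b, rel t i b /\ is_add (dom s) i l /\ is_pair l b p)
    (a := cup s (prod om (uni (uni t)))) _ _ p).
  - definability.
  - intros z [Hz|Hz]; apply in_cup; [auto|right].
    apply H in Hz; destruct Hz as (i & b & Hi & Hb & ->).
    apply in_prod; exists (add (dom s) i), b; rewrite in_om.
    apply rel_bound in Hb; split; [apply nat_add; auto|tauto].
Qed.

Lemma is_concatE s t u : is_nat (dom s) -> indexed t ->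
  is_concat s t u <-> u = cat s t.
Proof.
  intros Hs Ht; split.
  - intros (n & Hn & H); apply is_domE in Hn; subst n; apply setof_eq; exact H.
  - intros ->; exists (dom s); rewrite is_domE; split; auto; intro p.
    rewrite in_cat; auto.
    apply or_iff_compat_l; split.
    + intros (i & b & Hi & Hb & ->); exists i, (add (dom s) i), b.
      rewrite is_addE, is_pairE; auto.
    + intros (i & l & b & Hb & Hl & Hp); exists i, b.
      pose proof (rel_nat Ht Hb) as Hi.
      rewrite is_addE in Hl; auto; rewrite is_pairE in Hp; subst; auto.
Qed.

Lemma is_snocE s a u : is_nat (dom s) -> is_snoc s a u <-> u = cat s (single a).
Proof.
  intro Hs; unfold is_snoc; split.
  - intros (t & Ht & Hu); apply is_singleE in Ht; subst t.
    apply is_concatE in Hu; auto using indexed_single.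
  - intros ->; exists (single a); rewrite is_singleE, is_concatE; auto using indexed_single.
Qed.

Lemma rel_cat s t l b : is_nat (dom s) -> indexed t -> rel (cat s t) l b <->
  rel s l b \/ exists i, is_nat i /\ rel t i b /\ l = add (dom s) i.
Proof.
  intros Hs Ht; rewrite (relE (cat s t)), in_cat, <- relE; auto.
  apply or_iff_compat_l; split.
  - intros (i & b' & Hi & Hb & K); apply pr_inj in K; destruct K; subst; eauto.
  - intros (i & Hi & Hb & ->); eauto.
Qed.

(** Every natural is either below the length of [s] or of the form [|s| + i]; in
    these two ranges the concatenation reads as [s] and as [t]. All identities
    about concatenation follow from this splitting. *)
Lemma cat_lo X s t l b : finseq X s -> indexed t -> l ∈ dom s ->
  rel (cat s t) l b <-> rel s l b.
Proof.
  intros Hs Ht Hl; pose proof (fin_nat Hs) as Hn; rewrite rel_cat; auto; split; auto.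
  intros [H|(i & Hi & _ & ->)]; auto; destruct (add_not_lt Hn Hi Hl).
Qed.

Lemma cat_hi X s t i b : finseq X s -> indexed t -> is_nat i ->
  rel (cat s t) (add (dom s) i) b <-> rel t i b.
Proof.
  intros Hs Ht Hi; pose proof (fin_nat Hs) as Hn; rewrite rel_cat; auto; split.
  - intros [H|(i' & Hi' & H & K)].
    + destruct (add_not_lt Hn Hi); apply in_dom; eauto.
    + apply add_cancel in K; auto; subst; auto.
  - intro H; right; eauto.
Qed.

Lemma indexed_cat s t : is_nat (dom s) -> indexed s -> indexed t -> indexed (cat s t).
Proof.
  intros Hn Hs Ht p Hp; apply in_cat in Hp; auto.
  destruct Hp as [Hp|(i & b & Hi & Hb & ->)]; [auto|].
  exists (add (dom s) i), b; split; auto; apply nat_add; auto.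
Qed.

Lemma lt_or_add m l : is_nat m -> is_nat l ->
  l ∈ m \/ exists i, is_nat i /\ l = add m i.
Proof.
  intros Hm Hl; destruct (add_cases Hm Hl) as [H|(d & Hd & ->)]; auto.
  left; apply lt_add_S; auto.
Qed.

Lemma dom_cat X s t : finseq X s -> finseq X t -> dom (cat s t) = add (dom s) (dom t).
Proof.
  intros Hs Ht; pose proof (fin_nat Hs) as Hn; pose proof (fin_nat Ht) as Hm.
  pose proof (fin_indexed Ht) as It.
  apply ext; intro l; rewrite in_dom; split.
  - intros [b Hb]; apply rel_cat in Hb; auto; destruct Hb as [Hb|(i & Hi & Hb & ->)].
    + assert (K : l ∈ dom s) by (apply in_dom; eauto).
      destruct (nat_cases Hm) as [->|(m & Hm' & ->)]; [rewrite add_0; auto|].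
      apply (nat_down (nat_add Hn (nat_S Hm'))) with (i := dom s); auto.
      apply lt_add_S; auto.
    + apply add_lt; auto; apply in_dom; eauto.
  - intro Hl; assert (Nl : is_nat l) by (apply (nat_down (nat_add Hn Hm) Hl)).
    destruct (lt_or_add Hn Nl) as [K|(i & Hi & ->)].
    + apply in_dom in K; destruct K as [b Hb]; exists b; apply rel_cat; auto.
    + apply add_lt in Hl; auto; apply in_dom in Hl; destruct Hl as [b Hb].
      exists b; apply rel_cat; auto; right; eauto.
Qed.

Lemma fin_cat X s t : finseq X s -> finseq X t -> finseq X (cat s t).
Proof.
  intros Hs Ht; pose proof (fin_nat Hs) as Hn; pose proof (fin_nat Ht) as Hm.
  pose proof (fin_indexed Hs) as Is; pose proof (fin_indexed Ht) as It.
  apply finseqE; split; [apply indexed_cat; auto|split; [|split]].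
  - rewrite (dom_cat Hs Ht); apply nat_add; auto.
  - intros l b b' H H'.
    pose proof (rel_nat (indexed_cat Hn Is It) H) as Hl.
    destruct (lt_or_add Hn Hl) as [K|(i & Hi & ->)].
    + apply (cat_lo _ Hs It K) in H, H'; apply (fin_fun Hs H H').
    + apply (cat_hi _ Hs It Hi) in H, H'; apply (fin_fun Ht H H').
  - intros l b H; apply rel_cat in H; auto; destruct H as [H|(i & _ & H & _)];
      [apply (fin_val Hs H)|apply (fin_val Ht H)].
Qed.

Lemma cat_ext X s t y : finseq X s -> indexed t -> indexed y ->
  (forall l b, l ∈ dom s -> rel s l b <-> rel y l b) ->
  (forall i b, is_nat i -> rel t i b <-> rel y (add (dom s) i) b) -> cat s t = y.
Proof.
  intros Hs It Iy H1 H2; pose proof (fin_nat Hs) as Hn; pose proof (fin_indexed Hs) as Is.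
  apply seq_ext; auto using indexed_cat.
  intros l b Hl; destruct (lt_or_add Hn Hl) as [K|(i & Hi & ->)].
  - rewrite (cat_lo _ Hs It K); auto.
  - rewrite (cat_hi _ Hs It Hi); auto.
Qed.

Lemma cat_nil_l X t : finseq X t -> cat emp t = t.
Proof.
  intro Ht; pose proof (fin_indexed Ht).
  apply (cat_ext (fin_emp X)); auto; rewrite dom_emp.
  - intros l b Hl; apply in_emp in Hl; tauto.
  - intros i b Hi; rewrite add_0_l; tauto.
Qed.

Lemma cat_nil_r X s : finseq X s -> cat s emp = s.
Proof.
  intro Hs; apply (cat_ext Hs); [apply (fin_indexed (fin_emp X))|apply (fin_indexed Hs)| |].
  - tauto.
  - intros i b Hi; split; intro H; [destruct (rel_emp H)|].
    destruct (add_not_lt (fin_nat Hs) Hi); apply in_dom; eauto.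
Qed.

Lemma cat_assoc X s t u : finseq X s -> finseq X t -> finseq X u ->
  cat (cat s t) u = cat s (cat t u).
Proof.
  intros Hs Ht Hu; pose proof (fin_nat Hs) as Hn; pose proof (fin_nat Ht) as Hm.
  pose proof (fin_indexed Ht) as It; pose proof (fin_indexed Hu) as Iu.
  pose proof (fin_cat Hs Ht) as Hst; pose proof (fin_cat Ht Hu) as Htu.
  symmetry; apply (cat_ext Hs).
  - apply (fin_indexed Htu).
  - apply (fin_indexed (fin_cat Hst Hu)).
  - intros l b Hl; rewrite (cat_lo _ Hst Iu), (cat_lo _ Hs It Hl); [tauto|].
    apply in_dom in Hl; destruct Hl as [c Hc]; apply in_dom; exists c.
    apply rel_cat; auto.
  - intros i b Hi; destruct (lt_or_add Hm Hi) as [K|(i' & Hi' & ->)].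
    + rewrite (cat_lo _ Ht Iu K), (cat_lo _ Hst Iu), (cat_hi _ Hs It Hi); [tauto|].
      rewrite (dom_cat Hs Ht); apply add_lt; auto.
    + rewrite (cat_hi _ Ht Iu Hi'), <- add_assoc, <- (dom_cat Hs Ht),
        (cat_hi _ Hst Iu Hi'); auto; tauto.
Qed.

Lemma cat_inj X s t s' t' : finseq X s -> finseq X t -> finseq X s' -> finseq X t' ->
  dom s = dom s' -> cat s t = cat s' t' -> s = s' /\ t = t'.
Proof.
  intros Hs Ht Hs' Ht' Hd H.
  pose proof (fin_indexed Ht) as It; pose proof (fin_indexed Ht') as It'.
  split; apply seq_ext; auto; try apply (fin_indexed Hs); try apply (fin_indexed Hs').
  - intros l b Hl; destruct (lt_or_add (fin_nat Hs) Hl) as [K|(i & Hi & ->)].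
    + rewrite <- (cat_lo _ Hs It K), H, (cat_lo _ Hs' It'); [tauto|rewrite <- Hd; auto].
    + pose proof (add_not_lt (fin_nat Hs) Hi) as K; split; intro L; destruct K;
        [|rewrite Hd at 2]; apply in_dom; eauto.
  - intros i b Hi; rewrite <- (cat_hi _ Hs It Hi), H, Hd, (cat_hi _ Hs' It' Hi); tauto.
Qed.

Lemma restr_cat X s t : finseq X s -> finseq X t -> restr (cat s t) (dom s) = s.
Proof.
  intros Hs Ht; pose proof (fin_indexed Ht) as It; pose proof (fin_indexed Hs) as Is.
  apply seq_ext; auto.
  - apply indexed_restr, (fin_indexed (fin_cat Hs Ht)).
  - intros l b Hl; rewrite rel_restr; split.
    + intros [H K]; apply (cat_lo _ Hs It K) in H; auto.
    + intro H; assert (K : l ∈ dom s) by (apply in_dom; eauto).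
      rewrite (cat_lo _ Hs It K); auto.
Qed.

Lemma restr_id X s k : finseq X s -> (forall i, i ∈ dom s -> i ∈ k) -> restr s k = s.
Proof.
  intros Hs H; apply ext; intro p; rewrite in_restr; split; [tauto|].
  intro Hp; split; auto; destruct (fin_indexed Hs Hp) as (i & b & Hi & ->).
  exists i, b; split; auto; apply H, in_dom; exists b; apply relE; auto.
Qed.

Lemma fin_split X s k d : finseq X s -> is_nat k -> is_nat d -> dom s = add k d ->
  finseq X (restr s k) /\ dom (restr s k) = k /\
  finseq X (tail s k) /\ dom (tail s k) = d /\ s = cat (restr s k) (tail s k).
Proof.
  intros Hs Hk Hd H; pose proof (fin_indexed Hs) as Is.
  assert (D1 : dom (restr s k) = k).
  { apply ext; intro i; rewrite in_dom; split.
    - intros [b Hb]; apply rel_restr in Hb; tauto.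
    - intro Hi; assert (K : i ∈ dom s).
      { rewrite H; destruct (nat_cases Hd) as [->|(d' & Hd' & ->)]; [rewrite add_0; auto|].
        apply (nat_down (nat_add Hk (nat_S Hd')) (lt_add_S Hk Hd')); auto. }
      apply in_dom in K; destruct K as [b Hb]; exists b; apply rel_restr; auto. }
  assert (D2 : dom (tail s k) = d).
  { apply ext; intro i; rewrite in_dom; split.
    - intros [b Hb]; apply rel_tail in Hb; destruct Hb as [Hi Hb].
      apply (add_lt Hk Hi Hd); rewrite <- H; apply in_dom; eauto.
    - intro Hi; assert (Ni : is_nat i) by (apply (nat_down Hd Hi)).
      apply (add_lt Hk Ni Hd) in Hi; rewrite <- H in Hi; apply in_dom in Hi.
      destruct Hi as [b Hb]; exists b; apply rel_tail; auto. }
  assert (F1 : finseq X (restr s k)).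
  { apply finseqE; rewrite D1; split; [apply indexed_restr; auto|split; [auto|split]].
    - intros i b b' K L; apply rel_restr in K, L; apply (fin_fun Hs (proj1 K) (proj1 L)).
    - intros i b K; apply rel_restr in K; apply (fin_val Hs (proj1 K)). }
  assert (F2 : finseq X (tail s k)).
  { apply finseqE; rewrite D2; split; [apply indexed_tail|split; [auto|split]].
    - intros i b b' K L; apply rel_tail in K, L; apply (fin_fun Hs (proj2 K) (proj2 L)).
    - intros i b K; apply rel_tail in K; apply (fin_val Hs (proj2 K)). }
  repeat (split; auto).
  symmetry; apply (cat_ext F1); auto using indexed_tail; rewrite D1.
  - intros l b Hl; rewrite rel_restr; tauto.
  - intros i b Hi; rewrite rel_tail; tauto.
Qed.

(** This turns closure under restriction, as required of trees, into closure under
    prefixes in the sense of concatenation; a restriction beyond the length changes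
    nothing. *)
Lemma restr_prefix X s k : finseq X s -> is_nat k ->
  exists u, finseq X u /\ finseq X (restr s k) /\ s = cat (restr s k) u.
Proof.
  intros Hs Hk; destruct (add_cases Hk (fin_nat Hs)) as [(d & Hd & H)|(d & Hd & H)].
  - exists (tail s k); pose proof (fin_split Hs Hk Hd H); tauto.
  - exists emp; rewrite (restr_id Hs); [rewrite (cat_nil_r Hs); auto using fin_emp|].
    intros i Hi; rewrite H; apply (nat_down (nat_add (fin_nat Hs) (nat_S Hd))) with (dom s);
      auto; apply lt_add_S; auto; apply (fin_nat Hs).
Qed.

Lemma dom_snoc X s a : finseq X s -> a ∈ X -> dom (cat s (single a)) = succ (dom s).
Proof.
  intros Hs Ha; rewrite (dom_cat Hs (fin_single Ha)), dom_single, add_S, add_0;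
    auto using nat_0.
Qed.

Lemma dom_1 X s : finseq X s -> dom s = succ emp -> exists a, a ∈ X /\ s = single a.
Proof.
  intros Hs H; assert (K : emp ∈ dom s) by (rewrite H; apply in_succ; auto).
  apply in_dom in K; destruct K as [a Ha]; exists a; split; [apply (fin_val Hs Ha)|].
  apply seq_ext; [apply (fin_indexed Hs)|apply indexed_single|].
  intros i b _; rewrite rel_single; split.
  - intro K; assert (i = emp); [|subst i; split; auto; apply (fin_fun Hs K Ha)].
    assert (L : i ∈ dom s) by (apply in_dom; eauto).
    rewrite H in L; apply in_succ in L; destruct L as [L|L]; auto.
    apply in_emp in L; tauto.
  - intros [-> ->]; auto.
Qed.

Lemma snoc_cases X s : finseq X s ->
  s = emp \/ exists s' a, finseq X s' /\ a ∈ X /\ s = cat s' (single a).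
Proof.
  intro Hs; destruct (nat_cases (fin_nat Hs)) as [H|(n & Hn & H)].
  - left; apply (dom_0 Hs H).
  - right; destruct (fin_split (k := n) (d := succ emp) Hs) as (F1 & D1 & F2 & D2 & L);
      auto using nat_S, nat_0.
    + rewrite H, add_S, add_0; auto using nat_0.
    + destruct (dom_1 F2 D2) as (a & Ha & K); exists (restr s n), a.
      rewrite <- K; auto.
Qed.

Lemma fin_ind X (P : M -> Prop) : Def1 P -> P emp ->
  (forall s a, finseq X s -> a ∈ X -> P s -> P (cat s (single a))) ->
  forall s, finseq X s -> P s.
Proof.
  intros HP H0 HS s Hs.
  assert (K : forall n, is_nat n -> forall s, finseq X s -> dom s = n -> P s).
  { clear s Hs; nat_induction; [definability| |].
    - intros s Hs H; rewrite (dom_0 Hs H); auto.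
    - intros n Hn IH s Hs H; destruct (snoc_cases Hs) as [->|(s' & a & Hs' & Ha & ->)].
      + rewrite dom_emp in H; symmetry in H; destruct (succ_not_0 H).
      + apply HS; auto; apply IH; auto.
        rewrite (dom_snoc Hs' Ha) in H; apply succ_inj in H; auto; apply (fin_nat Hs'). }
  exact (K _ (fin_nat Hs) s Hs eq_refl).
Qed.

Lemma snoc_inj X s a s' a' : finseq X s -> finseq X s' -> a ∈ X -> a' ∈ X ->
  cat s (single a) = cat s' (single a') -> s = s' /\ a = a'.
Proof.
  intros Hs Hs' Ha Ha' H.
  apply (cat_inj (X := X)) in H; auto using fin_single.
  - destruct H as [-> H]; split; auto; apply single_inj; auto.
  - apply succ_inj; [apply (fin_nat Hs)|apply (fin_nat Hs')|].
    rewrite <- (dom_snoc Hs Ha), H; apply (dom_snoc Hs' Ha').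
Qed.

Lemma cons_inj X s a s' a' : finseq X s -> finseq X s' -> a ∈ X -> a' ∈ X ->
  cat (single a) s = cat (single a') s' -> a = a' /\ s = s'.
Proof.
  intros Hs Hs' Ha Ha' H.
  apply (cat_inj (X := X)) in H; auto using fin_single; [|rewrite !dom_single; auto].
  destruct H as [H ->]; split; auto; apply single_inj; auto.
Qed.

(** Finite sequences are built at their end; decomposing them at their beginning
    takes an induction. *)
Lemma cons_cases X s : finseq X s ->
  s = emp \/ exists a s', finseq X s' /\ a ∈ X /\ s = cat (single a) s'.
Proof.
  revert s; apply fin_ind; [definability|auto|].
  intros s a Hs Ha [->|(b & s' & Hs' & Hb & ->)]; right.
  - exists a, emp; rewrite (cat_nil_l (fin_single Ha)), (cat_nil_r (fin_single Ha)).
    auto using fin_emp.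
  - exists b, (cat s' (single a)); rewrite (cat_assoc (X := X)); auto using fin_single, fin_cat.
Qed.

Lemma snoc_not_nil X s a : finseq X s -> a ∈ X -> cat s (single a) <> emp.
Proof.
  intros Hs Ha H; apply (succ_not_0 (n := dom s)).
  rewrite <- (dom_snoc Hs Ha), H; apply dom_emp.
Qed.

Lemma snoc_val X s a : is_nat (dom s) -> finseq X (cat s (single a)) -> a ∈ X.
Proof.
  intros Hs H; apply (fin_val (i := add (dom s) emp) H).
  apply rel_cat; auto using indexed_single; right; exists emp.
  rewrite rel_single; auto using nat_0.
Qed.

(** ** Infinite sequences *)

Lemma omega_seqE X x : omega_seq X x <->
  indexed x /\ (forall i, is_nat i -> exists! b, rel x i b) /\
  (forall i b, rel x i b -> b ∈ X).
Proof.
  unfold omega_seq, is_fun_to, is_fun; split.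
  - intros (w & Hw & [H1 H2] & H3); apply is_omegaE in Hw; subst w.
    split; [|split; auto].
    + intros p Hp; destruct (H1 p Hp) as (i & b & H & Hi); exists i, b.
      rewrite is_pairE, in_om in *; auto.
    + intros i Hi; apply H2, in_om; auto.
  - intros (H1 & H2 & H3); exists om; rewrite is_omegaE; split; auto; split; auto; split.
    + intros p Hp; destruct (H1 p Hp) as (i & b & Hi & H); exists i, b.
      rewrite is_pairE, in_om; auto.
    + intros i Hi; apply H2, in_om; auto.
Qed.

Lemma omega_tail X x k : omega_seq X x -> is_nat k -> omega_seq X (tail x k).
Proof.
  rewrite !omega_seqE; intros (H1 & H2 & H3) Hk; split; [apply indexed_tail|split].
  - intros i Hi; destruct (H2 (add k i)) as (b & Hb & Hb'); [apply nat_add; auto|].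
    exists b; split; [apply rel_tail; auto|].
    intros b' K; apply rel_tail in K; apply Hb'; tauto.
  - intros i b H; apply rel_tail in H; destruct H as [_ H]; apply (H3 _ _ H).
Qed.

Lemma omega_restr X x k : omega_seq X x -> is_nat k ->
  finseq X (restr x k) /\ dom (restr x k) = k.
Proof.
  rewrite omega_seqE; intros (H1 & H2 & H3) Hk.
  assert (D : dom (restr x k) = k).
  { apply ext; intro i; rewrite in_dom; split.
    - intros [b Hb]; apply rel_restr in Hb; tauto.
    - intro Hi; destruct (H2 i) as (b & Hb & _); [apply (nat_down Hk Hi)|].
      exists b; apply rel_restr; auto. }
  split; auto; apply finseqE; rewrite D; split; [apply indexed_restr; auto|].
  split; [auto|split].
  - intros i b b' K L; apply rel_restr in K, L; destruct K as [K Hi], L as [L _].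
    destruct (H2 i) as (c & _ & Hc); [apply (nat_down Hk Hi)|].
    rewrite <- (Hc _ K); apply Hc; auto.
  - intros i b K; apply rel_restr in K; apply (H3 _ _ (proj1 K)).
Qed.

Lemma tail_0 X x : omega_seq X x -> tail x emp = x.
Proof.
  rewrite omega_seqE; intros (H & _); apply seq_ext; auto using indexed_tail.
  intros i b Hi; rewrite rel_tail, add_0_l; tauto.
Qed.

Lemma tail_tail x k l : is_nat k -> is_nat l -> tail (tail x k) l = tail x (add k l).
Proof.
  intros Hk Hl; apply seq_ext; auto using indexed_tail.
  intros i b Hi; rewrite !rel_tail, add_assoc; auto.
  pose proof (nat_add Hl Hi); tauto.
Qed.

Lemma restr_add X x k l : omega_seq X x -> is_nat k -> is_nat l ->
  restr x (add k l) = cat (restr x k) (restr (tail x k) l).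
Proof.
  intros Hx Hk Hl; destruct (omega_restr Hx Hk) as [F D].
  pose proof (proj1 (proj1 (omega_seqE X x) Hx)) as Ix.
  symmetry; apply (cat_ext F); auto using indexed_restr, indexed_tail; rewrite D.
  - intros i b Hi; rewrite !rel_restr; split; [|tauto].
    intros [H K]; split; auto.
    destruct (nat_cases Hl) as [->|(d & Hd & ->)]; [rewrite add_0; auto|].
    apply (nat_down (nat_add Hk (nat_S Hd)) (lt_add_S Hk Hd)); auto.
  - intros i b Hi; rewrite !rel_restr, rel_tail, add_lt; tauto.
Qed.

Lemma branchE x T : branch x T <-> forall k, is_nat k -> restr x k ∈ T.
Proof.
  split; intros H k Hk.
  - destruct (H k Hk) as (s & Hs & K); apply is_restrE in Hs; subst; auto.
  - exists (restr x k); rewrite is_restrE; auto.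
Qed.

End Sequences.

Ltac fin_induction :=
  match goal with
  | |- forall s, finseq ?X s -> @?P s => apply (fin_ind (X := X) (P := P)); cbv beta
  end.

(** * Large trees and the forcing order *)

Section Forcing.
Context {M : Type} {E : SetStr M} {HZ : ZF M}.
Context (X U : M) (HU : sigma_complete_ultrafilter X U).
Implicit Types a b c d f i k l m n p q r s t u v x y z A B S T : M.

(** Witnessed by a member of the ultrafilter instead of requiring [{a | P a}] to be
    one: monotonicity then needs no definability. *)
Definition many (P : M -> Prop) : Prop := exists A, A ∈ U /\ forall a, a ∈ A -> P a.

Lemma many_mono (P Q : M -> Prop) : (forall a, P a -> Q a) -> many P -> many Q.
Proof. intros H (A & HA & K); exists A; auto. Qed.

Lemma many_X : many (fun a => a ∈ X).
Proof. exists X; split; auto; apply HU. Qed.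

Lemma many_and (P Q : M -> Prop) : many P -> many Q -> many (fun a => P a /\ Q a).
Proof.
  intros (A & HA & HP) (B & HB & HQ).
  destruct HU as (_ & _ & _ & _ & Hcap & _).
  assert (K : exists C, forall z, z ∈ C <-> z ∈ A /\ z ∈ B).
  { apply (separation (P := fun z => z ∈ B)); definability. }
  destruct K as [C HC]; exists C; split; [apply (Hcap A B); auto|].
  intros a Ha; apply HC in Ha; destruct Ha; auto.
Qed.

Lemma many_inhabited (P : M -> Prop) : many P -> exists a, P a.
Proof.
  intros (A & HA & HP); destruct HU as (_ & _ & He & _).
  apply NNPP; intro K; apply (He A); auto; intros a Ha; apply K; eauto.
Qed.

Lemma in_sub (P : M -> Prop) z : Def1 P ->
  z ∈ setof (fun a => a ∈ X /\ P a) <-> z ∈ X /\ P z.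
Proof.
  intro HP.
  refine (in_setof (P := fun a => a ∈ X /\ P a) (a := X) _ _ z); [definability|tauto].
Qed.

Lemma many_setof (P : M -> Prop) : Def1 P -> many P -> setof (fun a => a ∈ X /\ P a) ∈ U.
Proof.
  intros HP (A & HA & H); destruct HU as (Hsub & _ & _ & Hup & _).
  apply (Hup A); auto.
  - intros a Ha; apply in_sub; auto; split; auto; apply (Hsub A); auto.
  - intros a Ha; apply in_sub in Ha; tauto.
Qed.

Lemma many_or_not (P : M -> Prop) : Def1 P -> many P \/ many (fun a => ~ P a).
Proof.
  intro HP; destruct HU as (_ & _ & _ & _ & _ & Hult & _).
  assert (HN : Def1 (fun a => ~ P a)) by definability.
  destruct (Hult (setof (fun a => a ∈ X /\ P a)) (setof (fun a => a ∈ X /\ ~ P a)))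
    as [H|H].
  - intros a Ha; apply in_sub in Ha; tauto.
  - intro z; rewrite !in_sub; tauto.
  - left; eexists; split; [exact H|]; intros a Ha; apply in_sub in Ha; tauto.
  - right; eexists; split; [exact H|]; intros a Ha; apply in_sub in Ha; tauto.
Qed.

(** Otherwise all the complements [{a | ~ R n a}] are in the ultrafilter. They form
    an internal sequence, so their intersection is in it too, and it is disjoint
    from the union of the sets [{a | R n a}]. *)
Lemma many_sigma (R : M -> M -> Prop) : Def2 R ->
  many (fun a => exists n, is_nat n /\ R n a) -> exists n, is_nat n /\ many (R n).
Proof.
  intros HR H; apply NNPP; intro K.
  assert (L : forall n, is_nat n -> setof (fun a => a ∈ X /\ ~ R n a) ∈ U).
  { intros n Hn; apply many_setof; [definability|].
    destruct (@many_or_not (R n)) as [J|J]; [definability| |auto].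
    destruct K; eauto. }
  set (F := fun n => pr n (setof (fun a => a ∈ X /\ ~ R n a))).
  assert (HF : Fun1 F) by (unfold F; definability).
  assert (Hf : forall i A, rel (image F om) i A <->
             is_nat i /\ A = setof (fun a => a ∈ X /\ ~ R i a)).
  { intros i A; rewrite relE, in_image; auto; unfold F; split.
    - intros (n & Hn & J); apply pr_inj in J; destruct J as [-> ->].
      apply in_om in Hn; auto.
    - intros [Hi ->]; exists i; rewrite in_om; auto. }
  set (f := image F om) in *.
  destruct HU as (_ & _ & _ & _ & _ & _ & Hsig).
  assert (B : setof (fun a => a ∈ X /\ forall i A, rel f i A -> a ∈ A) ∈ U).
  { apply (Hsig om f).
    - apply is_omegaE; auto.
    - split; [split|].
      + intros p Hp; apply in_image in Hp; auto; destruct Hp as (n & Hn & ->).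
        exists n; eexists; split; [apply is_pairE; reflexivity|auto].
      + intros n Hn; apply in_om in Hn.
        eexists; split; [apply Hf; split; [auto|reflexivity]|].
        intros A HA; apply Hf in HA; symmetry; tauto.
      + intros n A HA; apply Hf in HA; destruct HA as [Hn ->]; auto.
    - intro z; apply in_sub; definability. }
  destruct (many_inhabited (P := fun a => (exists n, is_nat n /\ R n a) /\
     forall i A, rel f i A -> a ∈ A)) as (a & (n & Hn & Ha) & J).
  - apply many_and; auto; eexists; split; [exact B|].
    intros a Ha; apply in_sub in Ha; [tauto|definability].
  - assert (N : a ∈ setof (fun a => a ∈ X /\ ~ R n a)) by (apply (J n), Hf; auto).
    apply in_sub in N; [tauto|definability].
Qed.

Notation large := (large_tree X U).
Notation fin := (finseq X).

Lemma largeE T : large T <->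
  (forall t, t ∈ T -> fin t) /\
  (forall s t, fin s -> fin t -> cat s t ∈ T -> s ∈ T) /\
  emp ∈ T /\
  (forall t, t ∈ T -> many (fun a => a ∈ X /\ cat t (single a) ∈ T)).
Proof.
  split.
  - intros ([H1 H2] & (e & He & H3) & H4); apply is_empty_emp in He; subst e.
    split; [auto|split; [|split; [auto|]]].
    + intros s t Hs Ht H; apply (H2 (cat s t) (dom s)); auto; [apply (fin_nat Hs)|].
      apply is_restrE; symmetry; apply (restr_cat Hs Ht).
    + intros t Ht; destruct (H4 t Ht) as (A & HA & K); exists A; split; auto.
      pose proof (H1 t Ht) as Ft.
      intros a Ha; apply HA in Ha; destruct Ha as (u & Hu & L).
      apply is_snocE in Hu; [|apply (fin_nat Ft)]; subst u; split; auto.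
      apply (snoc_val (fin_nat Ft) (H1 _ L)).
  - intros (H1 & H2 & H3 & H4); split; [split; auto|split].
    + intros t k s Ht Hk Hs; apply is_restrE in Hs; subst s.
      destruct (restr_prefix (H1 t Ht) Hk) as (u & Fu & Fr & L).
      apply (H2 _ u); auto; rewrite <- L; auto.
    + exists emp; rewrite is_empty_emp; auto.
    + intros t Ht; pose proof (H1 t Ht) as Ft.
      assert (D : Def1 (fun a => cat t (single a) ∈ T)) by definability.
      exists (setof (fun a => a ∈ X /\ cat t (single a) ∈ T)); split.
      * intro a; rewrite in_sub; auto; split.
        -- intros [Ha K]; exists (cat t (single a)); rewrite is_snocE; auto.
           apply (fin_nat Ft).
        -- intros (u & Hu & K); apply is_snocE in Hu; [|apply (fin_nat Ft)]; subst u.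
           split; auto; apply (snoc_val (fin_nat Ft) (H1 _ K)).
      * apply many_setof; auto; refine (many_mono _ (H4 t Ht)); tauto.
Qed.

Lemma large_fin T t : large T -> t ∈ T -> fin t.
Proof. rewrite largeE; intros H; apply H. Qed.

Lemma large_prefix T s t : large T -> fin s -> fin t -> cat s t ∈ T -> s ∈ T.
Proof. rewrite largeE; intros (_ & H & _); apply H. Qed.

Lemma large_emp T : large T -> emp ∈ T.
Proof. rewrite largeE; tauto. Qed.

Lemma large_many T t : large T -> t ∈ T -> many (fun a => a ∈ X /\ cat t (single a) ∈ T).
Proof. rewrite largeE; intros (_ & _ & _ & H); apply H. Qed.

Global Instance def_large : Def1 (large_tree X U).
Proof.
  unfold large_tree, is_tree, is_succ_set, is_snoc, is_single, is_concat, is_restr, is_dom.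
  definability.
Qed.

Lemma large_Fin : large (Fin X).
Proof.
  apply largeE; split; [|split; [|split]].
  - intro t; apply in_Fin.
  - intros s t Hs _ _; apply in_Fin; auto.
  - apply in_Fin, fin_emp.
  - intros t Ht; apply in_Fin in Ht; refine (many_mono _ many_X).
    intros a Ha; rewrite in_Fin; auto using fin_cat, fin_single.
Qed.

Definition cap S T : M := setof (fun t => t ∈ S /\ t ∈ T).

Lemma in_cap S T t : t ∈ cap S T <-> t ∈ S /\ t ∈ T.
Proof.
  refine (in_setof (P := fun t => t ∈ S /\ t ∈ T) (a := S) _ _ t); [definability|tauto].
Qed.

Lemma large_cap S T : large S -> large T -> large (cap S T).
Proof.
  intros HS HT; apply largeE; split; [|split; [|split]].
  - intros t Ht; apply in_cap in Ht; apply (large_fin HS); tauto.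
  - intros s t Hs Ht H; apply in_cap in H; apply in_cap; split.
    + apply (large_prefix (t := t) HS); tauto.
    + apply (large_prefix (t := t) HT); tauto.
  - apply in_cap; auto using large_emp.
  - intros t Ht; apply in_cap in Ht; destruct Ht as [H1 H2].
    refine (many_mono _ (many_and (large_many HS H1) (large_many HT H2))).
    intros a [K1 K2]; rewrite in_cap; tauto.
Qed.

Definition tree_at T r : M := setof (fun t => fin t /\ cat r t ∈ T).

Global Instance def_tree_at : Fun2 tree_at.
Proof. unfold tree_at; definability. Qed.

Lemma in_tree_at T r t : t ∈ tree_at T r <-> fin t /\ cat r t ∈ T.
Proof.
  refine (in_setof (P := fun t => fin t /\ cat r t ∈ T) (a := Fin X) _ _ t).
  - definability.
  - intros z Hz; apply in_Fin; tauto.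
Qed.

Lemma is_tree_atE T r T' : fin r -> is_tree_at X T r T' <-> T' = tree_at T r.
Proof.
  intro Hr.
  assert (K : forall t, (fin t /\ exists u, is_concat r t u /\ u ∈ T) <->
                   (fin t /\ cat r t ∈ T)).
  { intro t; split; intros [Ht H]; split; auto.
    - destruct H as (u & Hu & H).
      apply is_concatE in Hu; [|apply (fin_nat Hr)|apply (fin_indexed Ht)]; subst; auto.
    - exists (cat r t); rewrite is_concatE; [auto|apply (fin_nat Hr)|apply (fin_indexed Ht)]. }
  split.
  - intro H; apply setof_eq; intro t; rewrite <- K; apply H.
  - intros -> t; rewrite K; apply in_tree_at.
Qed.

Lemma large_tree_at T r : large T -> r ∈ T -> large (tree_at T r).
Proof.
  intros HT Hr; pose proof (large_fin HT Hr) as Fr.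
  apply largeE; split; [|split; [|split]].
  - intros t Ht; apply in_tree_at in Ht; tauto.
  - intros s t Fs Ft H; apply in_tree_at in H; apply in_tree_at; split; auto.
    apply (large_prefix (t := t) HT); auto using fin_cat.
    rewrite (cat_assoc Fr); tauto.
  - apply in_tree_at; rewrite (cat_nil_r Fr); auto using fin_emp.
  - intros t Ht; apply in_tree_at in Ht; destruct Ht as [Ft Ht].
    refine (many_mono _ (large_many HT Ht)); intros a [Ha K].
    rewrite in_tree_at, <- (cat_assoc Fr); auto using fin_cat, fin_single.
Qed.

(** For [S] a set of finite sequences this says that [S] is included in the
    tree of continuations of [t] in [T]. *)
Definition sub_at T t S : Prop := forall u, u ∈ S -> cat t u ∈ T.

Global Instance def_sub_at : Def3 sub_at.
Proof. unfold sub_at; definability. Qed.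

Lemma large_subtree_atE T t S : fin t ->
  large_subtree_at X U T t S <-> large S /\ sub_at T t S.
Proof.
  intro Ft; unfold large_subtree_at; split; intros [HS H]; split; auto.
  - destruct H as (R & HR & H); apply is_tree_atE in HR; auto; subst R.
    intros u Hu; apply H, in_tree_at in Hu; tauto.
  - exists (tree_at T t); rewrite is_tree_atE; auto; split; auto.
    intros u Hu; apply in_tree_at; split; auto; apply (large_fin HS Hu).
Qed.

Lemma sub_at_root T t S : large S -> fin t -> sub_at T t S -> t ∈ T.
Proof.
  intros HS Ft H; rewrite <- (cat_nil_r Ft); apply H, large_emp; auto.
Qed.

(** The tree of the sequences [a^u] with [a] in [A] and [u] in [F a]. The trees are
    given by a definable function because they cannot be chosen. *)
Lemma large_graft (F : M -> M) A : Fun1 F -> A ∈ U -> (forall a, a ∈ A -> large (F a)) ->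
  exists T, large T /\
    forall t, t ∈ T <-> t = emp \/ exists a u, a ∈ A /\ u ∈ F a /\ t = cat (single a) u.
Proof.
  intros HF HA HL.
  assert (HX : forall a, a ∈ A -> a ∈ X) by (destruct HU as [K _]; apply (K A HA)).
  destruct (separation (P := fun t => t = emp \/
    exists a u, a ∈ A /\ u ∈ F a /\ t = cat (single a) u) (Fin X)) as [T HT];
    [definability|].
  assert (K : forall t, t ∈ T <-> t = emp \/
     exists a u, a ∈ A /\ u ∈ F a /\ t = cat (single a) u).
  { intro t; rewrite HT; split; [tauto|intro H; split; auto; apply in_Fin].
    destruct H as [->|(a & u & Ha & Hu & ->)]; [apply fin_emp|].
    apply fin_cat; [apply fin_single; auto|apply (large_fin (HL a Ha) Hu)]. }
  exists T; split; [|exact K]; apply largeE; split; [|split; [|split]].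
  - intros t Ht; apply HT in Ht; apply in_Fin; tauto.
  - intros s t Fs Ft H; apply K; destruct (cons_cases Fs) as [->|(a & s' & Fs' & Xa & ->)];
      [auto|right].
    apply K in H; destruct H as [H|(b & u & Hb & Hu & H)].
    + exfalso. rewrite (cat_assoc (X := X)) in H; auto using fin_single.
      pose proof (fin_cat Fs' Ft) as Fst.
      apply (succ_not_0 (n := dom (cat s' t))).
      pose proof (dom_cat (fin_single Xa) Fst) as D.
      rewrite H, dom_emp, dom_single, add_S_l, add_0_l in D; auto; apply (fin_nat Fst).
    + pose proof (large_fin (HL b Hb) Hu) as Fu.
      rewrite (cat_assoc (X := X)) in H; auto using fin_single.
      apply (cons_inj (X := X)) in H; auto using fin_cat.
      destruct H as [-> <-]; exists b, s'; split; auto; split; auto.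
      apply (large_prefix (HL b Hb) Fs' Ft Hu).
  - apply K; auto.
  - intros t Ht; apply K in Ht; destruct Ht as [->|(a & u & Ha & Hu & ->)].
    + exists A; split; auto; intros a Ha; split; auto.
      apply K; right; exists a, emp; split; auto; split; [apply large_emp; auto|].
      rewrite (cat_nil_l (fin_single (HX a Ha))), (cat_nil_r (fin_single (HX a Ha))); auto.
    + refine (many_mono _ (large_many (HL a Ha) Hu)); intros b [Hb L]; split; auto.
      apply K; right; exists a, (cat u (single b)); split; auto; split; auto.
      apply (cat_assoc (X := X)); auto using fin_single; apply (large_fin (HL a Ha) Hu).
Qed.

(** ** Conditions *)

Lemma condition_pairE s T p : condition_pair X U s T p <-> p = pr s T /\ fin s /\ large T.
Proof. unfold condition_pair; rewrite is_pairE; tauto. Qed.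

Lemma conditionE p : condition X U p <-> exists s T, p = pr s T /\ fin s /\ large T.
Proof.
  unfold condition; split; intros (s & T & H); exists s, T; apply condition_pairE; auto.
Qed.

Lemma direct_extensionE p q : direct_extension X U p q <->
  exists s T T', p = pr s T /\ q = pr s T' /\ fin s /\ large T /\ large T' /\ subset T' T.
Proof.
  unfold direct_extension; split; intros (s & T & T' & H); exists s, T, T';
    rewrite !condition_pairE in *; tauto.
Qed.

Lemma one_point_extensionE p q : one_point_extension X U p q <->
  exists s T a, p = pr s T /\ fin s /\ large T /\ a ∈ X /\ single a ∈ T /\
    q = pr (cat s (single a)) (tree_at T (single a)).
Proof.
  unfold one_point_extension; split.
  - intros (s & T & a & e & A & l & s' & T' & Hp & He & HA & Ha & Hs & Hl & HT & Hq).
    apply condition_pairE in Hp; destruct Hp as (-> & Fs & HL).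
    apply is_empty_emp in He; subst e; apply is_singleE in Hl; subst l.
    apply is_snocE in Hs; [|apply (fin_nat Fs)]; subst s'.
    apply is_pairE in Hq; subst q.
    apply HA in Ha; destruct Ha as (u & Hu & K).
    apply is_snocE in Hu; [subst u|rewrite dom_emp; apply nat_0].
    assert (Ha : a ∈ X).
    { apply (snoc_val (s := emp)); [rewrite dom_emp; apply nat_0|apply (large_fin HL K)]. }
    rewrite (cat_nil_l (fin_single Ha)) in K.
    apply (is_tree_atE _ _ (fin_single Ha)) in HT; subst T'.
    exists s, T, a; auto 10.
  - intros (s & T & a & -> & Fs & HL & Ha & K & ->).
    pose proof HL as HL'; destruct HL' as (_ & _ & H).
    destruct (H emp (large_emp HL)) as (A & HA & _).
    exists s, T, a, emp, A, (single a), (cat s (single a)), (tree_at T (single a)).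
    rewrite condition_pairE, is_empty_emp, is_singleE, is_pairE,
      (is_tree_atE _ _ (fin_single Ha)), is_snocE by apply (fin_nat Fs).
    repeat (split; auto); apply HA; exists (single a); split; auto.
    rewrite is_snocE, (cat_nil_l (fin_single Ha)); [auto|rewrite dom_emp; apply nat_0].
Qed.

(** The closed form of the extension relation, free of internal recursion. *)
Definition weaker p q : Prop :=
  exists s T t S, p = pr s T /\ q = pr (cat s t) S /\
    fin s /\ large T /\ t ∈ T /\ large S /\ sub_at T t S.

Global Instance def_weaker : Def2 weaker.
Proof. unfold weaker; definability. Qed.

Lemma weaker_intro s T t S : fin s -> large T -> t ∈ T -> large S -> sub_at T t S ->
  weaker (pr s T) (pr (cat s t) S).
Proof. intros; exists s, T, t, S; auto 10. Qed.

Lemma weaker_sub s T S : fin s -> large T -> large S -> subset S T ->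
  weaker (pr s T) (pr s S).
Proof.
  intros Fs HT HS H; rewrite <- (cat_nil_r Fs) at 2.
  apply weaker_intro; auto using large_emp.
  intros u Hu; rewrite (cat_nil_l (large_fin HS Hu)); auto.
Qed.

Lemma weaker_trans p q r : weaker p q -> weaker q r -> weaker p r.
Proof.
  intros (s & T & t & S & -> & -> & Fs & HT & Ht & HS & Hsub)
    (s' & T' & t' & S' & H & -> & _ & _ & Ht' & HS' & Hsub').
  apply pr_inj in H; destruct H as [<- <-].
  pose proof (large_fin HT Ht) as Ft; pose proof (large_fin HS Ht') as Ft'.
  rewrite (cat_assoc Fs); auto; apply weaker_intro; auto.
  intros u Hu; rewrite (cat_assoc Ft); auto; apply (large_fin HS' Hu).
Qed.

Lemma step_weaker p q :
  direct_extension X U p q \/ one_point_extension X U p q -> weaker p q.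
Proof.
  rewrite direct_extensionE, one_point_extensionE.
  intros [(s & T & T' & -> & -> & Fs & HT & HT' & K)|
          (s & T & a & -> & Fs & HT & Ha & K & ->)].
  - apply weaker_sub; auto.
  - apply weaker_intro; auto using large_tree_at.
    intros u Hu; apply in_tree_at in Hu; tauto.
Qed.

Global Instance def_step :
  Def2 (fun p q => direct_extension X U p q \/ one_point_extension X U p q).
Proof.
  unfold direct_extension, one_point_extension, condition_pair, is_tree_at, is_succ_set,
    is_snoc, is_single, is_concat, is_dom.
  definability.
Qed.

Lemma tree_at_nil T : large T -> tree_at T emp = T.
Proof.
  intro HT; apply ext; intro t; rewrite in_tree_at; split.
  - intros [Ft H]; rewrite (cat_nil_l Ft) in H; auto.
  - intro H; pose proof (large_fin HT H) as Ft; rewrite (cat_nil_l Ft); auto.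
Qed.

Lemma tree_at_cat T s t : fin s -> fin t -> tree_at (tree_at T s) t = tree_at T (cat s t).
Proof.
  intros Fs Ft; apply ext; intro u; rewrite !in_tree_at; split.
  - intros (Fu & _ & H); rewrite (cat_assoc Fs); auto.
  - intros [Fu H]; rewrite (cat_assoc Fs) in H; auto using fin_cat.
Qed.

(** From left to right, both kinds of steps have the closed form and the closed
    form is transitive. From right to left, [(s, T)] reaches [(s^t, T_t)] by
    one-point extensions along [t], and then shrinks its tree to [S]. *)
Lemma extendsE p q : extends X U p q <-> weaker p q.
Proof.
  set (R := fun u v => direct_extension X U u v \/ one_point_extension X U u v).
  assert (DR : Def2 R) by apply def_step.
  split.
  - intros (Hp & n & Hn & H); revert q H.
    change (forall q, chain R p n q -> weaker p q).
    revert n Hn; nat_induction; [definability| |].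
    + intros q H; apply chain_0 in H; subst q.
      apply conditionE in Hp; destruct Hp as (s & T & -> & Fs & HT).
      apply weaker_sub; auto; intros u Hu; auto.
    + intros n Hn IH q H; apply chain_S in H; auto; destruct H as (r & H & K).
      apply (weaker_trans (IH r H)), step_weaker, K.
  - intros (s & T & t & S & -> & -> & Fs & HT & Ht & HS & Hsub).
    split; [apply conditionE; eauto 6|].
    change (exists n, is_nat n /\ chain R (pr s T) n (pr (cat s t) S)).
    pose proof (large_fin HT Ht) as Ft.
    assert (K : t ∈ T -> exists n, is_nat n /\
              chain R (pr s T) n (pr (cat s t) (tree_at T t))).
    { clear Ht Hsub; revert t Ft; fin_induction; [definability| |].
      - intros _; exists emp; rewrite chain_0, tree_at_nil, (cat_nil_r Fs); auto using nat_0.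
      - intros t a Ft Ha IH H.
        assert (Ht : t ∈ T) by (apply (large_prefix (t := single a) HT); auto using fin_single).
        destruct (IH Ht) as (n & Hn & K); exists (succ n); split; [apply nat_S; auto|].
        apply chain_S; auto; eexists; split; [exact K|right].
        apply one_point_extensionE; exists (cat s t), (tree_at T t), a.
        rewrite in_tree_at, tree_at_cat, (cat_assoc Fs);
          auto 10 using fin_cat, fin_single, large_tree_at. }
    destruct (K Ht) as (n & Hn & L); exists (succ n); split; [apply nat_S; auto|].
    apply chain_S; auto; eexists; split; [exact L|left].
    apply direct_extensionE; exists (cat s t), (tree_at T t), S.
    repeat (split; auto using fin_cat, large_tree_at).
    intros u Hu; apply in_tree_at; split; auto; apply (large_fin HS Hu).
Qed.

Lemma leq_succ_inv k n : is_nat k -> is_nat n -> leq (succ n) (succ k) -> leq n k.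
Proof.
  intros Hk Hn; rewrite !leq_iff; auto using nat_S; intros (d & Hd & K).
  exists d; split; auto; rewrite add_S_l in K; auto.
  apply succ_inj; auto using nat_add.
Qed.

Lemma cat_eq_emp s t : fin s -> fin t -> cat s t = emp -> s = emp.
Proof.
  intros Fs Ft H; destruct (snoc_cases Ft) as [->|(t' & a & Ft' & Ha & ->)].
  - rewrite (cat_nil_r Fs) in H; auto.
  - rewrite <- (cat_assoc Fs) in H; auto using fin_single.
    destruct (snoc_not_nil (fin_cat Fs Ft') Ha H).
Qed.

Lemma large_long T n : large T -> is_nat n -> exists t, t ∈ T /\ dom t = n.
Proof.
  intro HT; revert n; nat_induction; [definability| |].
  - exists emp; split; [apply large_emp; auto|apply dom_emp].
  - intros n Hn (t & Ht & H).
    destruct (many_inhabited (large_many HT Ht)) as (a & Ha & K).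
    exists (cat t (single a)); rewrite (dom_snoc (large_fin HT Ht) Ha), H; auto.
Qed.

Lemma SPSE T n P : SPS X U T n P <->
  large T /\ is_nat n /\
  (forall p, p ∈ P -> exists t S, p = pr t S) /\
  (forall t S, rel P t S -> fin t /\ leq n (dom t) /\ large S /\ sub_at T t S) /\
  (forall t, t ∈ T -> leq n (dom t) -> exists S, rel P t S) /\
  (forall t S S', t ∈ T -> leq n (dom t) ->
     rel P t S -> large S' -> subset S' S -> rel P t S').
Proof.
  unfold SPS; split.
  - intros (HT & Hn & H1 & H2); repeat (split; [assumption|]).
    assert (K : forall t S, rel P t S -> fin t /\ leq n (dom t) /\ large S /\ sub_at T t S).
    { intros t S H; apply relE in H; destruct (H1 _ H) as (t' & S' & l & Hp & Hl & Hnl & HS).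
      apply is_pairE, pr_inj in Hp; destruct Hp as [<- <-].
      apply seq_of_lenE in Hl; destruct Hl as [Ft ->].
      apply large_subtree_atE in HS; tauto. }
    assert (L : forall t, t ∈ T -> seq_of_len X (dom t) t).
    { intros t Ht; apply seq_of_lenE; split; auto; apply (large_fin HT Ht). }
    split; [|split; [auto|split]].
    + intros p Hp; destruct (H1 p Hp) as (t & S & l & H & _); exists t, S.
      apply is_pairE; auto.
    + intros t Ht Hl; apply (H2 t (dom t)); auto.
    + intros t S S' Ht Hl; apply (H2 t (dom t)); auto.
  - intros (HT & Hn & H1 & H2 & H3 & H4); repeat (split; [assumption|]); split.
    + intros p Hp; destruct (H1 p Hp) as (t & S & ->).
      destruct (H2 t S) as (Ft & Hl & HS & Hsub); [apply relE; auto|].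
      exists t, S, (dom t); rewrite is_pairE, seq_of_lenE, large_subtree_atE; auto.
    + intros t l Ht Hl Hnl; apply seq_of_lenE in Hl; destruct Hl as [Ft ->].
      split; [apply H3; auto|]; intros S S'; apply H4; auto.
Qed.

(** * The ground model side *)

(* [seg k i] stands for the piece of length [i] that starts at the index [k] of a
   sequence lying outside the structure. *)
Section Segments.
Variable seg : M -> M -> M.
Hypothesis seg_fin : forall k i, is_nat k -> is_nat i -> fin (seg k i).
Hypothesis seg_dom : forall k i, is_nat k -> is_nat i -> dom (seg k i) = i.
Hypothesis seg_add : forall k i l, is_nat k -> is_nat i -> is_nat l ->
  seg k (add i l) = cat (seg k i) (seg (add k i) l).

(** The tail from [k] on is a branch through [T]. *)
Definition thread k T : Prop := forall i, is_nat i -> seg k i ∈ T.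

Definition gen p : Prop :=
  exists k T, is_nat k /\ p = pr (seg emp k) T /\ large T /\ thread k T.

(** A decomposition of a piece of the sequence is determined by its lengths, so its
    parts are pieces as well. *)
Lemma seg_split m k s t : is_nat m -> is_nat k -> fin s -> fin t -> seg m k = cat s t ->
  k = add (dom s) (dom t) /\ s = seg m (dom s) /\ t = seg (add m (dom s)) (dom t).
Proof.
  intros Hm Hk Fs Ft H; pose proof (fin_nat Fs) as Ns; pose proof (fin_nat Ft) as Nt.
  assert (K : k = add (dom s) (dom t)).
  { rewrite <- (dom_cat Fs Ft), <- H, seg_dom; auto. }
  split; [exact K|]; rewrite K, seg_add in H; auto.
  apply (cat_inj (X := X)) in H; auto using nat_add.
  destruct H; auto.
Qed.

(** Lengths up to [i] are prefixes of a node of [T]; longer ones are that node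
    followed by a node of [S]. *)
Lemma thread_sub k i T S : is_nat k -> is_nat i -> large T -> large S ->
  sub_at T (seg k i) S -> thread (add k i) S -> thread k T.
Proof.
  intros Hk Hi HT HS Hsub H m Hm.
  destruct (add_cases Hi Hm) as [(d & Hd & ->)|(d & Hd & K)].
  - rewrite seg_add; auto.
  - assert (L : seg k i ∈ T) by (apply (sub_at_root HS); auto).
    rewrite K, seg_add in L; auto using nat_S.
    apply (large_prefix HT) in L; auto using nat_S, nat_add.
Qed.

Lemma gen_up p q : gen q -> weaker p q -> gen p.
Proof.
  intros (k & S' & Hk & -> & HS & Hth) (s & T & t & S & -> & K & Fs & HT & Ht & _ & Hsub).
  apply pr_inj in K; destruct K as [K <-]; pose proof (large_fin HT Ht) as Ft.
  destruct (seg_split nat_0 Hk Fs Ft K) as (-> & Ks & Kt).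
  pose proof (fin_nat Fs) as Ns; rewrite add_0_l in Kt; auto.
  exists (dom s), T; repeat (split; [congruence||auto|]).
  apply (thread_sub (i := dom t) (S := S')); auto; [apply (fin_nat Ft)|].
  rewrite <- Kt; auto.
Qed.

Lemma gen_dir k T l S : is_nat k -> is_nat l -> large T -> large S ->
  thread k T -> thread (add k l) S ->
  exists r, gen r /\ weaker (pr (seg emp k) T) r /\ weaker (pr (seg emp (add k l)) S) r.
Proof.
  intros Hk Hl HT HS Kt Ks.
  set (C := cap (tree_at T (seg k l)) S).
  assert (HC : large C) by (apply large_cap; auto; apply large_tree_at; auto).
  exists (pr (seg emp (add k l)) C); split; [|split].
  - exists (add k l), C; repeat (split; auto using nat_add).
    intros i Hi; apply in_cap; split; auto; apply in_tree_at.
    rewrite <- seg_add; auto using nat_add.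
  - rewrite seg_add, add_0_l; auto using nat_0.
    apply weaker_intro; auto using nat_0.
    intros u Hu; apply in_cap in Hu; destruct Hu as [Hu _]; apply in_tree_at in Hu; tauto.
  - apply weaker_sub; auto using nat_0, nat_add.
    intros u Hu; apply in_cap in Hu; tauto.
Qed.

Lemma gen_filter : is_filter X U gen.
Proof.
  split; [|split; [|split]].
  - intros p (k & T & Hk & -> & HT & _); apply conditionE.
    exists (seg emp k), T; auto using nat_0.
  - exists (pr (seg emp emp) (Fin X)), emp, (Fin X).
    repeat (split; auto using nat_0, large_Fin).
    intros i Hi; apply in_Fin; auto using nat_0.
  - intros p q Hq H; apply extendsE in H; apply (gen_up Hq H).
  - intros p q (k & T & Hk & -> & HT & Kt) (l & S & Hl & -> & HS & Ks).
    destruct (add_cases Hk Hl) as [(d & Hd & ->)|(d & Hd & ->)].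
    + destruct (gen_dir Hk Hd HT HS Kt Ks) as (r & Hr & H1 & H2).
      exists r; rewrite !extendsE; auto.
    + destruct (gen_dir Hl (nat_S Hd) HS HT Ks Kt) as (r & Hr & H1 & H2).
      exists r; rewrite !extendsE; auto.
Qed.

(** The tail from [m] on fits the system attached to the first [m] entries,
    expressed through pieces only. *)
Definition fits_at Phi m : Prop :=
  exists T n P k S, rel Phi (seg emp m) (triple T n P) /\ thread m T /\
    is_nat k /\ leq n k /\ large S /\ sub_at T (seg m k) S /\
    rel P (seg m k) S /\ thread (add m k) S.

Lemma GPSE Phi : GPS X U Phi ->
  (forall r, fin r -> exists T n P, rel Phi r (triple T n P)) /\
  (forall r T n P, rel Phi r (triple T n P) -> fin r /\ SPS X U T n P).
Proof.
  intros [(D & HD & [H1 H2]) H3]; split.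
  - intros r Hr; destruct (H2 r) as (v & Hv & _); [apply HD; auto|].
    destruct (H3 r v Hv) as (T & n & P & K & _); exists T, n, P.
    apply is_tripleE in K; subst; auto.
  - intros r T n P H; destruct (H3 r _ H) as (T' & n' & P' & K & L).
    apply is_tripleE, triple_inj in K; destruct K as (<- & <- & <-); split; auto.
    apply relE in H; destruct (H1 _ H) as (r' & v & K & Hr).
    apply is_pairE, pr_inj in K; destruct K as [-> _]; apply HD; auto.
Qed.

(** ** Generic sequences fit every system *)

Lemma generic_fits Phi : (forall D, dense X U D -> exists p, p ∈ D /\ gen p) ->
  GPS X U Phi -> exists m, is_nat m /\ fits_at Phi m.
Proof.
  intros Hgen HPhi; destruct (GPSE HPhi) as [H1 H2].
  set (Q := fun p => exists r t S T n P,
    rel Phi r (triple T n P) /\ rel P t S /\ p = pr (cat r t) S).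
  destruct (separation (P := Q) (prod (Fin X) (pow (Fin X)))) as [D HD].
  { unfold Q, triple; definability. }
  assert (HD' : forall r t S T n P, rel Phi r (triple T n P) -> rel P t S ->
             pr (cat r t) S ∈ D).
  { intros r t S T n P Hr HP; apply HD; split.
    - destruct (H2 _ _ _ _ Hr) as [Fr HS]; apply SPSE in HS.
      destruct HS as (HT & Hn & _ & K & _); destruct (K t S HP) as (Ft & _ & HS & _).
      apply in_prod; exists (cat r t), S; rewrite in_Fin, in_pow.
      split; [apply fin_cat; auto|split; [|auto]].
      intros u Hu; apply in_Fin, (large_fin HS Hu).
    - exists r, t, S, T, n, P; auto. }
  assert (Dd : dense X U D).
  { split.
    - intros p Hp; apply HD in Hp.
      destruct Hp as [_ (r & t & S & T & n & P & Hr & HP & ->)].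
      destruct (H2 _ _ _ _ Hr) as [Fr HS]; apply SPSE in HS.
      destruct HS as (HT & Hn & _ & K & _); destruct (K t S HP) as (Ft & _ & HS & _).
      apply conditionE; exists (cat r t), S; auto using fin_cat.
    - intros p Hp; apply conditionE in Hp; destruct Hp as (s & T0 & -> & Fs & HT0).
      destruct (H1 s Fs) as (T & n & P & Hs); destruct (H2 _ _ _ _ Hs) as [_ HS].
      apply SPSE in HS; destruct HS as (HT & Hn & _ & K1 & K2 & K3).
      pose proof (large_cap HT0 HT) as HC.
      destruct (large_long HC Hn) as (t & Ht & Hd).
      pose proof (large_fin HC Ht) as Ft.
      pose proof Ht as Ht'; apply in_cap in Ht'; destruct Ht' as [Ht0 HtT].
      assert (Hl : leq n (dom t)) by (right; auto).
      destruct (K2 t HtT Hl) as (S0 & HP0).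
      destruct (K1 t S0 HP0) as (_ & _ & HS0 & _).
      set (S1 := cap S0 (tree_at (cap T0 T) t)).
      assert (HS1 : large S1) by (apply large_cap; auto; apply large_tree_at; auto).
      exists (pr (cat s t) S1); split.
      + apply (HD' s t S1 T n P); auto; apply (K3 t S0); auto.
        intros u Hu; apply in_cap in Hu; tauto.
      + apply extendsE, weaker_intro; auto.
        intros u Hu; apply in_cap in Hu; destruct Hu as [_ Hu].
        apply in_tree_at in Hu; destruct Hu as [_ Hu]; apply in_cap in Hu; tauto. }
  destruct (Hgen D Dd) as (p & Hp & (k & S & Hk & -> & HS & Hth)).
  apply HD in Hp; destruct Hp as [_ (r & t & S' & T & n & P & Hr & HP & K)].
  apply pr_inj in K; destruct K as [K <-].
  destruct (H2 _ _ _ _ Hr) as [Fr HSPS]; apply SPSE in HSPS.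
  destruct HSPS as (HT & Hn & _ & K1 & _); destruct (K1 t S HP) as (Ft & Hl & _ & Hsub).
  destruct (seg_split nat_0 Hk Fr Ft K) as (-> & Kr & Kt).
  pose proof (fin_nat Fr) as Nr; pose proof (fin_nat Ft) as Nt.
  rewrite add_0_l in Kt; auto.
  exists (dom r); split; auto.
  exists T, n, P, (dom t), S; rewrite <- Kr, <- Kt.
  split; [exact Hr|split; [|auto 10]].
  apply (thread_sub (i := dom t) (S := S)); auto; rewrite <- Kt; auto.
Qed.

(** ** Ranks, and the system attached to a dense set *)

Section Dense.
Variable D : M.
Hypothesis HD : dense X U D.

Definition decided s : Prop := exists S d, large S /\ d ∈ D /\ weaker d (pr s S).

Definition witness n s T : Prop :=
  large T /\ forall u, u ∈ T -> leq n (dom u) -> decided (cat s u).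

Definition good n s : Prop := exists T, witness n s T.

(** The union of all witnesses, a canonical choice among them. *)
Definition hull n s : M := setof (fun t => exists T, witness n s T /\ t ∈ T).

Global Instance def_decided : Def1 decided.
Proof. unfold decided; definability. Qed.
Global Instance def_witness : Def3 witness.
Proof. unfold witness; definability. Qed.
Global Instance def_good : Def2 good.
Proof. unfold good; definability. Qed.
Global Instance def_hull : Fun2 hull.
Proof. unfold hull; definability. Qed.

Lemma in_hull n s t : t ∈ hull n s <-> exists T, witness n s T /\ t ∈ T.
Proof.
  refine (in_setof (P := fun t => exists T, witness n s T /\ t ∈ T) (a := Fin X) _ _ t).
  - definability.
  - intros z (T & [HT _] & Hz); apply in_Fin, (large_fin HT Hz).
Qed.

(** Both clauses defining a witness are local to a node, and a node of the union
    lies in a witness whose successors survive in the union. *)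
Lemma hull_witness n s : good n s -> witness n s (hull n s).
Proof.
  intros (T0 & H0); split.
  - apply largeE; split; [|split; [|split]].
    + intros t Ht; apply in_hull in Ht; destruct Ht as (T & [HT _] & Ht).
      apply (large_fin HT Ht).
    + intros t u Ft Fu Ht; apply in_hull in Ht; destruct Ht as (T & HT & Ht).
      apply in_hull; exists T; split; auto; apply (large_prefix (proj1 HT) Ft Fu Ht).
    + apply in_hull; exists T0; split; auto; apply large_emp, H0.
    + intros t Ht; apply in_hull in Ht; destruct Ht as (T & HT & Ht).
      refine (many_mono _ (large_many (proj1 HT) Ht)); intros a [Ha K]; split; auto.
      apply in_hull; eauto.
  - intros u Hu Hl; apply in_hull in Hu; destruct Hu as (T & [_ HT] & Hu); auto.
Qed.

(** A tree witnessing that [s] is decided also decides every longer stem through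
    it, because anything below an element of [D] stays so when extended. *)
Lemma decided_good s S d : fin s -> large S -> d ∈ D -> weaker d (pr s S) -> good emp s.
Proof.
  intros Fs HS Hd H; exists S; split; auto; intros u Hu _.
  exists (tree_at S u), d; split; [apply large_tree_at; auto|split; auto].
  apply (weaker_trans H), weaker_intro; auto using large_tree_at.
  intros v Hv; apply in_tree_at in Hv; tauto.
Qed.

Lemma good_step n s : fin s -> is_nat n ->
  many (fun a => a ∈ X /\ good n (cat s (single a))) -> good (succ n) s.
Proof.
  intros Fs Hn (A & HA & H).
  destruct (large_graft (F := fun a => hull n (cat s (single a))) (A := A))
    as (T & HT & K); auto.
  - definability.
  - intros a Ha; apply hull_witness, H; auto.
  - exists T; split; auto; intros u Hu Hl; apply K in Hu.
    destruct Hu as [->|(a & u' & Ha & Hu & ->)].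
    + exfalso; rewrite dom_emp in Hl.
      destruct Hl as [Hl|Hl]; [apply in_emp in Hl; auto|destruct (succ_not_0 Hl)].
    + destruct (H a Ha) as [Xa Ga]; pose proof (hull_witness Ga) as [L1 L2].
      pose proof (large_fin L1 Hu) as Fu.
      rewrite <- (cat_assoc Fs); auto using fin_single; apply L2; auto.
      pose proof (fin_nat Fu) as Nu.
      rewrite (dom_cat (fin_single Xa) Fu), dom_single, add_S_l, add_0_l in Hl; auto.
      apply leq_succ_inv; auto.
Qed.

(** The bad sequences all of whose prefixes are bad form a large tree if the empty
    one is bad: were almost all successors of a bad [t] good, one rank would do
    for almost all of them and [t] would be good. Density below the condition with
    this tree then yields a decided bad stem. *)
Lemma all_good s : fin s -> exists n, is_nat n /\ good n s.
Proof.
  intro Fs; apply NNPP; intro Hbad.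
  set (bad := fun t => ~ exists n, is_nat n /\ good n (cat s t)).
  assert (Db : Def1 bad) by (unfold bad; definability).
  destruct (separation (P := fun t => forall t' u, fin t' -> fin u -> t = cat t' u -> bad t')
              (Fin X)) as [B HB]; [definability|].
  assert (Bb : forall t, t ∈ B -> bad t).
  { intros t Ht; apply HB in Ht; rewrite in_Fin in Ht; destruct Ht as [Ft Ht].
    apply (Ht t emp); auto using fin_emp; rewrite (cat_nil_r Ft); auto. }
  assert (LB : large B).
  { apply largeE; split; [|split; [|split]].
    - intros t Ht; apply in_Fin; apply HB in Ht; tauto.
    - intros t u Ft Fu Ht; apply HB in Ht; destruct Ht as [_ Ht]; apply HB.
      split; [apply in_Fin; auto|]; intros t' u' Ft' Fu' ->.
      apply (Ht t' (cat u' u)); auto using fin_cat; apply (cat_assoc Ft'); auto.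
    - apply HB; split; [apply in_Fin, fin_emp|]; intros t' u Ft' Fu H; symmetry in H.
      apply cat_eq_emp in H; auto; subst t'; unfold bad; rewrite (cat_nil_r Fs); auto.
    - intros t Ht; pose proof (Bb t Ht) as Hb.
      apply HB in Ht; destruct Ht as [Ft Ht]; apply in_Fin in Ft.
      set (R := fun n a => good n (cat s (cat t (single a)))).
      assert (DR : Def2 R) by (unfold R; definability).
      destruct (@many_or_not (fun a => exists n, is_nat n /\ R n a)) as [H|H];
        [definability| |].
      + exfalso; apply many_sigma in H; auto; destruct H as (n & Hn & H).
        apply Hb; exists (succ n); split; [apply nat_S; auto|].
        apply good_step; auto using fin_cat.
        refine (many_mono _ (many_and many_X H)); intros a [Ha K]; split; [exact Ha|].
        rewrite (cat_assoc Fs Ft (fin_single Ha)); exact K.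
      + refine (many_mono _ (many_and many_X H)); intros a [Ha K]; split; [exact Ha|].
        pose proof (fin_single Ha) as Fa; apply HB.
        split; [apply in_Fin, fin_cat; assumption|].
        intros t' u Ft' Fu L.
        (* A prefix of [t^a] is [t^a] itself or a prefix of [t]. *)
        destruct (snoc_cases Fu) as [->|(u' & b & Fu' & Hu' & ->)].
        * rewrite (cat_nil_r Ft') in L; subst t'; exact K.
        * pose proof (fin_single Hu') as Fb; pose proof (fin_cat Ft' Fu') as Ftu.
          rewrite <- (cat_assoc Ft' Fu' Fb) in L.
          apply (snoc_inj Ft Ftu Ha Hu') in L; destruct L as [L _].
          exact (Ht t' u' Ft' Fu' L). }
  destruct HD as [_ HD2]; destruct (HD2 (pr s B)) as (q & Hq & L).
  { apply conditionE; eauto. }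
  apply extendsE in L; destruct L as (s' & T & t & S & L & -> & _ & _ & Ht & HS & _).
  apply pr_inj in L; destruct L as [<- <-]; pose proof (large_fin LB Ht) as Ft.
  apply (Bb t Ht); exists emp; split; [apply nat_0|].
  apply (decided_good (S := S) (d := pr (cat s t) S)); auto using fin_cat.
  apply weaker_sub; auto using fin_cat; intros u Hu; auto.
Qed.

Definition rank s : M :=
  the (fun n => is_nat n /\ good n s /\ forall m, m ∈ n -> ~ good m s).

Global Instance def_rank : Fun1 rank.
Proof. unfold rank; definability. Qed.

Lemma rank_good s : fin s -> is_nat (rank s) /\ good (rank s) s.
Proof.
  intro Fs; destruct (@least_nat _ _ _ (fun n => good n s)) as (n & Hn & Hn').
  - definability.
  - apply all_good; auto.
  - replace (rank s) with n; [tauto|symmetry].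
    apply the_eq; [exact Hn|]; intros m Hm; symmetry; apply Hn'; auto.
Qed.

Definition rank_tree s : M := hull (rank s) s.

Definition rank_pred s : M :=
  setof (fun p => exists t S, p = pr t S /\ fin t /\ leq (rank s) (dom t) /\ large S /\
    sub_at (rank_tree s) t S /\ exists d, d ∈ D /\ weaker d (pr (cat s t) S)).

Lemma in_rank_pred s p : p ∈ rank_pred s <->
  exists t S, p = pr t S /\ fin t /\ leq (rank s) (dom t) /\ large S /\
    sub_at (rank_tree s) t S /\ exists d, d ∈ D /\ weaker d (pr (cat s t) S).
Proof.
  revert p; apply (in_setof (a := prod (Fin X) (pow (Fin X)))).
  - unfold rank_tree; definability.
  - intros p (u & S' & -> & Fu & _ & HS & _); apply in_prod; exists u, S'.
    rewrite in_Fin, in_pow; split; auto; split; auto.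
    intros v Hv; apply in_Fin, (large_fin HS Hv).
Qed.

Lemma rel_rank_pred s t S : rel (rank_pred s) t S <->
  fin t /\ leq (rank s) (dom t) /\ large S /\ sub_at (rank_tree s) t S /\
  exists d, d ∈ D /\ weaker d (pr (cat s t) S).
Proof.
  rewrite relE, in_rank_pred; split.
  - intros (t' & S' & K & L); apply pr_inj in K; destruct K as [<- <-]; exact L.
  - intro K; exists t, S; auto.
Qed.

(** Some [S] with [rank_pred s] exists at every [t] in the tree whose length is at
    least the rank, and not just at those whose length equals it, since being
    decided passes to longer stems; this is built into witnesses. *)
Lemma rank_SPS s : fin s -> SPS X U (rank_tree s) (rank s) (rank_pred s).
Proof.
  intro Fs; destruct (rank_good Fs) as [Hn Hg]; pose proof (hull_witness Hg) as [HT K].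
  fold (rank_tree s) in HT, K.
  apply SPSE; repeat (split; [assumption|]); split; [|split; [|split]].
  - intros p Hp; apply in_rank_pred in Hp; destruct Hp as (t & S & -> & _); eauto.
  - intros t S H; apply rel_rank_pred in H; tauto.
  - intros t Ht Hl; destruct (K t Ht Hl) as (S & d & HS & Hd & L).
    pose proof (large_fin HT Ht) as Ft.
    exists (cap S (tree_at (rank_tree s) t)).
    assert (HC : large (cap S (tree_at (rank_tree s) t)))
      by (apply large_cap; auto; apply large_tree_at; auto).
    apply rel_rank_pred; repeat (split; [assumption|]); split.
    + intros u Hu; apply in_cap in Hu; destruct Hu as [_ Hu]; apply in_tree_at in Hu; tauto.
    + exists d; split; auto; apply (weaker_trans L), weaker_sub; auto using fin_cat.
      intros u Hu; apply in_cap in Hu; tauto.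
  - intros t S S' Ht Hl H HS' Hsub; apply rel_rank_pred in H.
    destruct H as (Ft & _ & HS & H & d & Hd & L).
    apply rel_rank_pred; repeat (split; [assumption|]); split.
    + intros u Hu; auto.
    + exists d; split; auto; apply (weaker_trans L), weaker_sub; auto using fin_cat.
Qed.

(** If the tail from [m] on fits the system, then for some [k] the stem of length
    [m + k] carries a condition of the generated filter below an element of [D]. *)
Lemma fits_meets : (forall Phi, GPS X U Phi -> exists m, is_nat m /\ fits_at Phi m) ->
  exists p, p ∈ D /\ gen p.
Proof.
  intro H.
  set (F := fun r => pr r (triple (rank_tree r) (rank r) (rank_pred r))).
  assert (DF : Fun1 F).
  { unfold F, triple, rank_pred, rank_tree; definability. }
  assert (HF : forall r v, rel (image F (Fin X)) r v <->
           fin r /\ v = triple (rank_tree r) (rank r) (rank_pred r)).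
  { intros r v; rewrite relE, in_image; auto; unfold F; split.
    - intros (r' & Hr & K); apply pr_inj in K; destruct K as [-> ->].
      apply in_Fin in Hr; auto.
    - intros [Hr ->]; exists r; rewrite in_Fin; auto. }
  destruct (H (image F (Fin X)))
    as (m & Hm & T & n & P & k & S & K & _ & Hk & _ & HS & _ & L & Hth).
  - split.
    + exists (Fin X); split; [apply in_Fin|split].
      * intros p Hp; apply in_image in Hp; auto; destruct Hp as (r & Hr & ->).
        exists r; eexists; split; [apply is_pairE; reflexivity|auto].
      * intros r Hr; apply in_Fin in Hr.
        eexists; split; [apply HF; split; [auto|reflexivity]|].
        intros v Hv; apply HF in Hv; symmetry; tauto.
    + intros r v Hv; apply HF in Hv; destruct Hv as [Fr ->].
      exists (rank_tree r), (rank r), (rank_pred r); rewrite is_tripleE.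
      split; auto; apply rank_SPS; auto.
  - apply HF in K; destruct K as [_ K]; apply triple_inj in K; destruct K as (-> & -> & ->).
    apply rel_rank_pred in L; destruct L as (_ & _ & _ & _ & d & Hd & L).
    exists d; split; auto.
    apply (gen_up (q := pr (cat (seg emp m) (seg m k)) S)); auto.
    exists (add m k), S; rewrite seg_add, add_0_l; auto using nat_0, nat_add.
Qed.

End Dense.

Lemma gen_generic : generic X U gen <->
  forall Phi, GPS X U Phi -> exists m, is_nat m /\ fits_at Phi m.
Proof.
  split.
  - intros [_ H] Phi; apply generic_fits; auto.
  - intro H; split; [apply gen_filter|]; intros D HD; apply (fits_meets HD); auto.
Qed.

End Segments.
End Forcing.

(** * Transfer to the outer model *)

Section Transfer.
Context {V W : Type} {EV : SetStr V} {EW : SetStr W} {ZFV : ZF V} {ZFW : ZF W}.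
Variable j : V -> W.
Hypothesis Hj : outer_model V W j.

Lemma mem_j a w : w ∈ j a <-> exists b, w = j b /\ b ∈ a.
Proof.
  split.
  - intro H; destruct (outer_transitive Hj H) as [b ->]; exists b; split; auto.
    apply (outer_mem Hj); auto.
  - intros (b & -> & H); apply (outer_mem Hj); auto.
Qed.

Lemma j_emp : j emp = emp.
Proof.
  apply is_empty_emp; intros w Hw; apply mem_j in Hw; destruct Hw as (b & _ & Hb).
  apply in_emp in Hb; auto.
Qed.

Lemma j_upair a b : j (upair a b) = upair (j a) (j b).
Proof.
  apply ext; intro w; rewrite mem_j, in_upair; split.
  - intros (c & -> & Hc); apply in_upair in Hc; destruct Hc; subst; auto.
  - intros [->| ->]; eexists; rewrite in_upair; auto.
Qed.

Lemma j_pr a b : j (pr a b) = pr (j a) (j b).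
Proof. unfold pr; rewrite !j_upair; auto. Qed.

Lemma j_succ n : j (succ n) = succ (j n).
Proof.
  apply ext; intro w; rewrite mem_j, in_succ; split.
  - intros (c & -> & Hc); apply in_succ in Hc; rewrite (outer_mem Hj).
    destruct Hc; subst; auto.
  - intros [H| ->]; [apply mem_j in H; destruct H as (b & -> & H)|];
      eexists; rewrite in_succ; auto.
Qed.

Lemma rel_j f u v : rel (j f) u v <-> exists a b, u = j a /\ v = j b /\ rel f a b.
Proof.
  rewrite relE; split.
  - intro H; apply mem_j in H; destruct H as (p & Hp & H).
    assert (K : upair u v ∈ j p) by (rewrite <- Hp; apply in_upair; auto).
    apply mem_j in K; destruct K as (q & Hq & K).
    assert (Ku : u ∈ j q) by (rewrite <- Hq; apply in_upair; auto).
    assert (Kv : v ∈ j q) by (rewrite <- Hq; apply in_upair; auto).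
    apply mem_j in Ku, Kv; destruct Ku as (a & -> & _), Kv as (b & -> & _).
    exists a, b; split; auto; split; auto; apply relE.
    rewrite <- j_pr in Hp; apply (outer_inj Hj) in Hp; rewrite Hp; auto.
  - intros (a & b & -> & -> & H); apply relE in H; rewrite <- j_pr.
    apply (outer_mem Hj); auto.
Qed.

Lemma rel_jj f a b : rel (j f) (j a) (j b) <-> rel f a b.
Proof.
  rewrite rel_j; split; [|eauto].
  intros (a' & b' & Ha & Hb & H); apply (outer_inj Hj) in Ha, Hb; subst; auto.
Qed.

(** The two structures have the same naturals: a least natural of the ground model
    that is not one of the outer model would be the successor of one that is. *)
Lemma nat_j n : is_nat n -> is_nat (j n).
Proof.
  intro Hn; apply NNPP; intro H.
  destruct (separation (P := fun w => ~ is_nat w) (j om)) as [b Hb]; [definability|].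
  destruct (ZF_foundation ZFW (a := b)) as (z & Hz & K).
  { exists (j n); apply Hb; rewrite (outer_mem Hj), in_om; auto. }
  apply Hb in Hz; destruct Hz as [Hz Nz]; apply mem_j in Hz; destruct Hz as (i & -> & Hi).
  apply in_om in Hi; destruct (nat_cases Hi) as [->|(m & Hm & ->)].
  - rewrite j_emp in Nz; apply Nz, nat_0.
  - apply K; exists (j m); rewrite (outer_mem Hj), in_succ; split; auto.
    apply Hb; rewrite (outer_mem Hj), in_om; split; auto.
    intro L; apply Nz; rewrite j_succ; apply nat_S; auto.
Qed.

Lemma nat_j_inv w : is_nat w -> exists n, is_nat n /\ w = j n.
Proof.
  intro Hw; assert (K : w ∈ j om).
  { apply Hw, inductiveE; split.
    - rewrite <- j_emp, (outer_mem Hj), in_om; apply nat_0.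
    - intros z Hz; apply mem_j in Hz; destruct Hz as (n & -> & Hn).
      rewrite <- j_succ, (outer_mem Hj); apply in_om, nat_S, in_om; auto. }
  apply mem_j in K; destruct K as (n & -> & Hn); exists n; rewrite <- in_om; auto.
Qed.

(** The induction has to take place in one of the structures; it is internal to the
    outer one because the graph of [add m] is a set of the ground model. *)
Lemma add_j m n : is_nat m -> is_nat n -> j (add m n) = add (j m) (j n).
Proof.
  intros Hm Hn; set (F := fun n => pr n (add m n)).
  assert (DF : Fun1 F) by (unfold F; definability).
  set (A := image F om).
  assert (HA : forall i b, rel A i b <-> is_nat i /\ b = add m i).
  { intros i b; unfold A; rewrite relE, in_image; auto; unfold F; split.
    - intros (i' & Hi & K); apply pr_inj in K; destruct K as [-> ->].
      apply in_om in Hi; auto.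
    - intros [Hi ->]; exists i; rewrite in_om; auto. }
  assert (K : forall w, is_nat w -> rel (j A) w (add (j m) w)).
  { nat_induction; [definability| |].
    - rewrite add_0, <- j_emp, rel_jj, HA, add_0; auto using nat_0.
    - intros w Hw IH; apply rel_j in IH; destruct IH as (i & b & -> & Hb & IH).
      apply HA in IH; destruct IH as [Hi ->].
      rewrite add_S, Hb, <- !j_succ, rel_jj, HA, add_S; auto using nat_S. }
  pose proof (K (j n) (nat_j Hn)) as L; apply rel_j in L.
  destruct L as (i & b & Hi & -> & L); apply (outer_inj Hj) in Hi; subst i.
  apply HA in L; destruct L as [_ ->]; auto.
Qed.

Lemma leq_j m n : leq (j m) (j n) <-> leq m n.
Proof.
  unfold leq; rewrite (outer_mem Hj); split; intros [H|H]; auto.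
  - right; apply (outer_inj Hj); auto.
  - subst; auto.
Qed.

Lemma dom_j s : j (dom s) = dom (j s).
Proof.
  apply ext; intro w; rewrite mem_j, in_dom; split.
  - intros (i & -> & Hi); apply in_dom in Hi; destruct Hi as [b Hb].
    exists (j b); apply rel_jj; auto.
  - intros [b Hb]; apply rel_j in Hb; destruct Hb as (i & c & -> & -> & Hc).
    exists i; rewrite in_dom; eauto.
Qed.

Lemma fin_j X s : finseq X s -> finseq (j X) (j s).
Proof.
  rewrite !finseqE; intros (H1 & H2 & H3 & H4); split; [|split; [|split]].
  - intros p Hp; apply mem_j in Hp; destruct Hp as (q & -> & Hq).
    destruct (H1 q Hq) as (i & b & Hi & ->); exists (j i), (j b).
    rewrite j_pr; auto using nat_j.
  - rewrite <- dom_j; apply nat_j; auto.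
  - intros i b b' H H'; apply rel_j in H, H'.
    destruct H as (i0 & c & -> & -> & H), H' as (i1 & c' & K & -> & H').
    apply (outer_inj Hj) in K; subst i1; f_equal; eapply H3; eauto.
  - intros i b H; apply rel_j in H; destruct H as (i0 & c & -> & -> & H).
    apply (outer_mem Hj); eauto.
Qed.

Lemma cat_j X s t : finseq X s -> finseq X t -> j (cat s t) = cat (j s) (j t).
Proof.
  intros Fs Ft; pose proof (fin_nat Fs) as Ns; pose proof (fin_indexed Ft) as It.
  pose proof (fin_nat (fin_j Fs)) as Ns'; pose proof (fin_indexed (fin_j Ft)) as It'.
  apply ext; intro w; rewrite mem_j, in_cat; auto; split.
  - intros (p & -> & Hp); apply in_cat in Hp; auto.
    destruct Hp as [Hp|(i & b & Hi & Hb & ->)]; [left; apply (outer_mem Hj); auto|right].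
    exists (j i), (j b); rewrite rel_jj, j_pr, add_j, dom_j; auto using nat_j.
  - intros [H|(i & b & Hi & Hb & ->)].
    + apply mem_j in H; destruct H as (p & -> & Hp); exists p; rewrite in_cat; auto.
    + apply rel_j in Hb; destruct Hb as (i0 & b0 & -> & -> & Hb).
      pose proof (rel_nat It Hb) as Ni.
      exists (pr (add (dom s) i0) b0); rewrite j_pr, add_j, dom_j; auto; split; auto.
      apply in_cat; auto; right; eauto.
Qed.

(** Adding a point leads from the ground model to the ground model. The induction
    is internal to the outer model, where membership in the image of the set of
    finite sequences is a definable property. *)
Lemma fin_j_inv X w : finseq (j X) w -> exists s, finseq X s /\ w = j s.
Proof.
  intro Hw; assert (K : w ∈ j (Fin X)).
  { revert w Hw; fin_induction; [definability| |].
    - apply mem_j; exists emp; rewrite j_emp, in_Fin; auto using fin_emp.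
    - intros w a _ Ha IH; apply mem_j in IH, Ha.
      destruct IH as (s & -> & Hs), Ha as (b & -> & Hb); apply in_Fin in Hs.
      apply mem_j; exists (cat s (single b)).
      rewrite in_Fin, (cat_j Hs (fin_single Hb)); unfold single at 2.
      rewrite j_upair, j_pr, j_emp; auto using fin_cat, fin_single. }
  apply mem_j in K; destruct K as (s & -> & Hs); exists s; rewrite <- in_Fin; auto.
Qed.

Variables (X U : V) (HU : sigma_complete_ultrafilter X U).
Variable x : W.
Hypothesis Hx : omega_seq (j X) x.

(** The ground model element whose image is the piece of [x] of length [i] from [k]
    on. *)
Definition segment k i : V := the (fun s => j s = restr (tail x (j k)) (j i)).

Lemma segment_spec k i : is_nat k -> is_nat i ->
  finseq X (segment k i) /\ j (segment k i) = restr (tail x (j k)) (j i).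
Proof.
  intros Hk Hi.
  destruct (omega_restr (omega_tail Hx (nat_j Hk)) (nat_j Hi)) as [F _].
  destruct (fin_j_inv F) as (s & Fs & Hs).
  assert (K : segment k i = s).
  { apply the_eq; auto; intros t Ht; apply (outer_inj Hj); congruence. }
  rewrite K; auto.
Qed.

Lemma segment_fin k i : is_nat k -> is_nat i -> finseq X (segment k i).
Proof. intros Hk Hi; apply segment_spec; auto. Qed.

Lemma segment_j k i : is_nat k -> is_nat i ->
  j (segment k i) = restr (tail x (j k)) (j i).
Proof. intros Hk Hi; apply segment_spec; auto. Qed.

Lemma segment_dom k i : is_nat k -> is_nat i -> dom (segment k i) = i.
Proof.
  intros Hk Hi; apply (outer_inj Hj); rewrite dom_j, segment_j; auto.
  apply (omega_restr (omega_tail Hx (nat_j Hk)) (nat_j Hi)).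
Qed.

Lemma segment_add k i l : is_nat k -> is_nat i -> is_nat l ->
  segment k (add i l) = cat (segment k i) (segment (add k i) l).
Proof.
  intros Hk Hi Hl; apply (outer_inj Hj).
  rewrite (cat_j (X := X)), !segment_j, !add_j, <- tail_tail;
    auto using nat_add, nat_j, segment_fin.
  apply (restr_add (X := j X)); auto using omega_tail, nat_j.
Qed.

Lemma segment_0 k : is_nat k -> j (segment emp k) = restr x (j k).
Proof. intro Hk; rewrite segment_j, j_emp, (tail_0 Hx); auto using nat_0. Qed.

Lemma branch_thread k T : is_nat k -> branch (tail x (j k)) (j T) <-> thread segment k T.
Proof.
  intro Hk; rewrite branchE; split.
  - intros H i Hi; apply (outer_mem Hj); rewrite segment_j; auto using nat_j.
  - intros H w Hw; destruct (nat_j_inv Hw) as (i & Hi & ->).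
    rewrite <- segment_j, (outer_mem Hj); auto.
Qed.

Lemma generated_filterE p : generated_filter j X U x p <-> gen X U segment p.
Proof.
  unfold generated_filter, gen; split.
  - intros (s & T & w & y & Hp & Hw & Hs & Hy & Hb).
    destruct (nat_j_inv Hw) as (k & Hk & ->).
    apply condition_pairE in Hp; destruct Hp as (-> & _ & HT).
    apply is_restrE in Hs; apply is_tailE in Hy; subst y.
    rewrite <- segment_0 in Hs; auto; apply (outer_inj Hj) in Hs; subst s.
    apply branch_thread in Hb; auto; exists k, T; auto.
  - intros (k & T & Hk & -> & HT & Hth).
    exists (segment emp k), T, (j k), (tail x (j k)).
    rewrite condition_pairE, is_restrE, is_tailE, branch_thread, segment_0;
      auto 10 using nat_j, segment_fin, nat_0.
Qed.

Lemma tail_fitsE Phi m : is_nat m ->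
  tail_fits j X U Phi x (j m) <-> fits_at X U segment Phi m.
Proof.
  intro Hm; unfold tail_fits, fits, fits_at; split.
  - intros (r & v & T & n & P & y & Hr & Hv & Ht & Hy & Hb &
      w & y' & t & S & Hw & Hl & Hk & HS & HP & Hy' & Hb').
    destruct (nat_j_inv Hw) as (k & Nk & ->).
    apply is_tripleE in Ht; subst v.
    apply is_tailE in Hy; subst y; apply is_tailE in Hy'; subst y'.
    apply is_restrE in Hr, Hk; rewrite <- segment_0 in Hr; auto.
    rewrite <- segment_j in Hk; auto.
    apply (outer_inj Hj) in Hr, Hk; subst r t.
    rewrite tail_tail, <- add_j in Hb' by auto using nat_j.
    apply branch_thread in Hb, Hb'; auto using nat_add.
    apply (large_subtree_atE HU) in HS; [|apply segment_fin; auto].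
    destruct HS as [HS Hsub]; apply leq_j in Hl.
    exists T, n, P, k, S; auto 10.
  - intros (T & n & P & k & S & Hv & Hb & Nk & Hl & HS & Hsub & HP & Hb').
    exists (segment emp m), (triple T n P), T, n, P, (tail x (j m)).
    rewrite is_restrE, segment_0, is_tripleE, is_tailE, branch_thread; auto.
    repeat (split; [auto; fail|]).
    exists (j k), (tail x (j (add m k))), (segment m k), S.
    rewrite leq_j, is_restrE, segment_j, (large_subtree_atE HU), is_tailE, branch_thread,
      add_j, tail_tail; auto 10 using nat_j, nat_add, segment_fin.
Qed.

Lemma generic_ext (G G' : V -> Prop) : (forall p, G p <-> G' p) ->
  generic X U G -> generic X U G'.
Proof.
  intros H [(H1 & (p & Hp) & H2 & H3) H4]; split; [split; [|split; [|split]]|].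
  - intros q Hq; apply H1, H; auto.
  - exists p; apply H; auto.
  - intros q r Hr K; apply H; apply (H2 q r); auto; apply H; auto.
  - intros q r Hq Hr; destruct (H3 q r) as (t & Ht & K); try (apply H; auto).
    exists t; split; auto; apply H; auto.
  - intros D HD; destruct (H4 D HD) as (q & Hq & K); exists q; split; auto; apply H; auto.
Qed.

End Transfer.

Theorem theorem43 (V W : Type) (EV : SetStr V) (EW : SetStr W)
    (ZFV : ZF V) (ZFW : ZF W)
    (j : V -> W) (Hj : outer_model V W j)
    (X U : V) (HU : sigma_complete_ultrafilter X U)
    (x : W) (Hx : omega_seq (j X) x) :
  generic X U (generated_filter j X U x) <->
  (forall Phi : V, GPS X U Phi ->
     exists m : W, is_nat m /\ tail_fits j X U Phi x m).
Proof.
  pose proof (generated_filterE Hj U Hx) as HG.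
  assert (K : generic X U (generated_filter j X U x) <->
              generic X U (gen X U (segment j x))).
  { split; apply generic_ext; intro p; rewrite HG; tauto. }
  rewrite K, (gen_generic HU (segment_fin Hj Hx) (segment_dom Hj Hx) (segment_add Hj Hx)).
  split; intros H Phi HPhi; destruct (H Phi HPhi) as (m & Hm & Hf).
  - exists (j m); split; [apply (nat_j Hj); auto|].
    apply (tail_fitsE Hj HU Hx); auto.
  - destruct (nat_j_inv Hj Hm) as (k & Hk & ->); exists k; split; auto.
    apply (tail_fitsE Hj HU Hx) in Hf; auto.
Qed.
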